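(* Let $\mathcal C$ be a Lawvere theory with a zero object. There is an adjunction (the eigenmonad adjunction associated with $(\mathtt L_{\mathcal C},\mathtt I^{\mathsf{pr}}_{\mathcal C})$) $$\mathbb L:\Phi_{\mathcal C}\text{-}\mathsf{Mod}\rightleftarrows\mathtt L_{\mathcal C}\text{-}\mathsf{Mod}:\mathbb R,\qquad \mathbb L\dashv\mathbb R,$$ with $\mathbb L=(\mathtt L_{\mathcal C}/\mathtt I^{\mathsf{pr}}_{\mathcal C})\otimes_{\Phi_{\mathcal C}}(-)$ and $\mathbb R=\mathrm{Hom}_{\mathtt L_{\mathcal C}}(\mathtt L_{\mathcal C}/\mathtt I^{\mathsf{pr}}_{\mathcal C},-)$. Furthermore, if $\mathcal C$ satisfies (ZM* ), then these functors respect the polynomial degree: for every $d\in\mathbb N$, $\mathbb R$ sends $\mathtt L_{\mathcal C}$-modules of polynomial degree at most $d$ to $d$-truncated $\Phi_{\mathcal C}$-modules, and $\mathbb L$ sends $d$-truncated $\Phi_{\mathcal C}$-modules to $\mathtt L_{\mathcal C}$-modules of polynomial degree at most $d$.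
   Context: $\Bbbk$ is a fixed commutative unital ring; $\mathbb N=\{0,1,2,\dots\}$. Monads and modules. A monad $\mathtt T$ on a set $\mathcal X$ (in the bicategory of matrices of $\Bbbk$-modules) is a family of $\Bbbk$-modules $\mathtt T(Y,X)$ with associative bilinear composition $\mathtt T(Z,Y)\otimes\mathtt T(Y,X)\to\mathtt T(Z,X)$ and units $1_X\in\mathtt T(X,X)$ (equivalently a $\Bbbk$-linear category with object set $\mathcal X$ and morphisms $X\to Y$ given by $\mathtt T(Y,X)$). A left $\mathtt T$-module $\mathtt M$ is a family $\mathtt M(X)$ with associative unital actions $\mathtt T(Y,X)\otimes\mathtt M(X)\to\mathtt M(Y)$, $f\otimes v\mapsto f\rhd v$; $\mathtt T\text{-}\mathsf{Mod}$ is the category of these. For monads $\mathtt T,\mathtt S$ on $\mathcal X,\mathcal Y$, a $(\mathtt T,\mathtt S)$-bimodule is a family $\mathtt B(X,Y)$ with commuting actions $\mathtt T(X',X)\otimes\mathtt B(X,Y)\to\mathtt B(X',Y)$ and $\mathtt B(X,Y)\otimes\mathtt S(Y,Y')\to\mathtt B(X,Y')$. For a left $\mathtt S$-module $\mathtt N$, $(\mathtt B\otimes_{\mathtt S}\mathtt N)(X)$ is $\bigoplus_Y\mathtt B(X,Y)\otimes\mathtt N(Y)$ modulo $(b\lhd s)\otimes v-b\otimes(s\rhd v)$; for a left $\mathtt T$-module $\mathtt M$, $\mathrm{Hom}_{\mathtt T}(\mathtt B,\mathtt M)(Y)$ is the module of left $\mathtt T$-module maps $\mathtt B(-,Y)\to\mathtt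 M$, a left $\mathtt S$-module by $(s\rhd\varphi)(b)=\varphi(b\lhd s)$. Eigenmonads. A left ideal $\mathtt J\subset\mathtt T$ is a family of submodules with $\mathtt T\circ\mathtt J\subset\mathtt J$. $\mathrm{Iz}(\mathtt J)(Y,X)=\{f\in\mathtt T(Y,X):\mathtt J(Z,Y)\circ f\subset\mathtt J(Z,X)\ \forall Z\}$ is a submonad containing $\mathtt J$ as a two-sided ideal; the eigenmonad is $\mathrm E_{\mathtt T}(\mathtt J)=\mathrm{Iz}(\mathtt J)/\mathtt J$. Composition in $\mathtt T$ makes $\mathtt T/\mathtt J$ a $(\mathtt T,\mathrm E_{\mathtt T}(\mathtt J))$-bimodule. Lawvere theories. A Lawvere theory is a category $\mathcal C$ with finite products and object set $\mathbb N$, the product on objects being addition. $\mathtt L_{\mathcal C}$ is the monad on $\mathbb N$ with $\mathtt L_{\mathcal C}(m,n)=\Bbbk[\mathcal C(n,m)]$; left $\mathtt L_{\mathcal C}$-modules are the same as functors $\mathcal C\to\Bbbk\text{-}\mathsf{Mod}$ ($\mathcal C$-modules). Let $\mathcal C$ have a zero object, $\Delta\in\mathcal C(1,2)$ the diagonal, $\eta\in\mathcal C(0,1)$ the zero morphism. For $n\ge1$, $1\le k\le n$ put $\bar\Delta^{n,k}=\mathrm{id}_{k-1}\times\Delta\times\mathrm{id}_{n-k}-\mathrm{id}_k\times\eta\times\mathrm{id}_{n-k}-\mathrm{id}_{k-1}\times\eta\times\mathrm{id}_{n-k+1}\in\mathtt L_{\mathcal C}(n+1,n)$. The primitivity ideal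 $\mathtt I^{\mathsf{pr}}_{\mathcal C}$ is the left ideal of $\mathtt L_{\mathcal C}$ generated by all $\bar\Delta^{n,k}$, and $\Phi_{\mathcal C}=\mathrm E_{\mathtt L_{\mathcal C}}(\mathtt I^{\mathsf{pr}}_{\mathcal C})$. Polynomial degree. For $d\ge1$, $n=n_1+\dots+n_d$, let $\rho_r\in\mathcal C(n,n)$ be the product of the identities $\mathrm{id}_{n_k}$ ($k\ne r$) and, in the $r$-th place, the zero morphism of $\mathcal C(n_r,n_r)$. The $d$-th cross effect is $\mathrm{cr}_d(\mathtt M)(n_1,\dots,n_d)=\bigcap_r\ker(\rho_r\rhd(-):\mathtt M(n)\to\mathtt M(n))$. $\mathtt M$ has polynomial degree at most $d\in\mathbb N$ if $\mathrm{cr}_{d+1}(\mathtt M)\cong0$. A left $\Phi_{\mathcal C}$-module $\mathtt N$ is $d$-truncated if $\mathtt N(n)=0$ for $n>d$. Condition (ZM* ). Write $\mathcal C_n=\mathcal C(n,1)$, $p_{n,k}\in\mathcal C(n,1)$ the $k$-th projection. (ZM* ): (Z) $\mathcal C$ has a zero object; (M) the object $1$ is equipped with a specified monoid object structure in $(\mathcal C,\times)$, so each $\mathcal C_n$ is a monoid naturally in $n$; (M* ) for each $n$ the monoid $\mathcal C_n$ is generated by $\bigcup_{k=1}^n\{f\circ p_{n,k}:f\in\mathcal C_1\}$. *)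

(* Defs.v *)
From HB Require Import structures.
From mathcomp Require Import all_boot all_order all_algebra.
From mathcomp Require Import generic_quotient ring_quotient.
From mathcomp Require Import boolp classical_sets functions cardinality fsbigop.

Set Implicit Arguments.
Unset Strict Implicit.
Unset Printing Implicit Defensive.

Import GRing.Theory.
Local Open Scope classical_set_scope.
Local Open Scope ring_scope.

Section LinearFun.
Variables (k : comPzRingType) (U V : lmodType k) (f : U -> V).
Hypothesis f_lin : linear f.

Let fL : {linear U -> V} := HB.pack f (GRing.isLinear.Build k U V _ f f_lin).

Lemma lin0 : f 0 = 0. Proof. exact: (linear0 fL). Qed.
Lemma linD x y : f (x + y) = f x + f y. Proof. exact: (linearD fL). Qed.
Lemma linB x y : f (x - y) = f x - f y. Proof. exact: (linearB fL). Qed.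
Lemma linZ a x : f (a *: x) = a *: f x. Proof. exact: (linearZ_LR fL). Qed.
Lemma lin_sum J (r : seq J) (F : J -> U) :
  f (\sum_(i <- r) F i) = \sum_(i <- r) f (F i).
Proof. exact: (linear_sum fL). Qed.
End LinearFun.

Lemma lin_comp (k : comPzRingType) (U V W : lmodType k) (f : V -> W) (g : U -> V) :
  linear f -> linear g -> linear (f \o g).
Proof. by move=> fl gl a x y; rewrite /= gl fl. Qed.

Section Span.
Variables (k : comPzRingType) (V : lmodType k).

(* The submodule generated by G. *)
Definition span (G : set V) : {pred V} :=
  fun x => `[< forall S : submodClosed V, (forall g, G g -> g \in S) -> x \in S >].

Fact span_submod G : subsemimod_closed (span G).
Proof.
split; first split.
- by apply/asboolP => S _; exact: rpred0.
- move=> x y /asboolP Gx /asboolP Gy; apply/asboolP => S GS.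
  by apply: rpredD; [exact: Gx | exact: Gy].
- move=> a x /asboolP Gx; apply/asboolP => S GS; apply: rpredZ; exact: Gx.
Qed.

HB.instance Definition _ G := GRing.isSubmodClosed.Build k V (span G) (span_submod G).

Lemma mem_span (G : set V) g : G g -> g \in span G.
Proof. by move=> Gg; apply/asboolP => S; apply. Qed.

Lemma span_sub (G : set V) (S : submodClosed V) x :
  (forall g, G g -> g \in S) -> x \in span G -> x \in S.
Proof. by move=> GS /asboolP; apply. Qed.

Lemma span_ker (W : lmodType k) (f : V -> W) (G : set V) x :
  linear f -> (forall g, G g -> f g = 0) -> x \in span G -> f x = 0.
Proof.
move=> fl fG; pose K : {pred V} := fun x => f x == 0.
have K_closed : subsemimod_closed K.
  split; first split.
  - by rewrite unfold_in (lin0 fl).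
  - by move=> u v /eqP fu /eqP fv; rewrite unfold_in (linD fl) fu fv addr0.
  - by move=> a u /eqP fu; rewrite unfold_in (linZ fl) fu scaler0.
pose KS : submodClosed V := HB.pack K (GRing.isSubmodClosed.Build k V K K_closed).
move=> /(@span_sub G KS) xK; apply/eqP; apply: xK => g Gg.
by apply/eqP; exact: fG.
Qed.

End Span.

Section QuotientModule.
Variables (k : comPzRingType) (V : lmodType k) (S : submodClosed V).

(* submodClosed carries no instance of zmodClosed, which ring_quotient needs;
   -1 *: x provides closure under opposites. *)
Definition submod_zmod : V -> bool := fun x => x \in S.

Fact submod_zmod_closed : zmod_closed submod_zmod.
Proof.
split=> [|x y]; first exact: rpred0.
by move=> Sx Sy; apply: rpredD => //; rewrite -scaleN1r rpredZ.
Qed.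
Definition submod_zmodClosed : GRing.ZmodClosed.type V :=
  HB.pack submod_zmod (GRing.isZmodClosed.Build V submod_zmod submod_zmod_closed).

Definition quotmod : Type := Quotient.quot submod_zmodClosed.
HB.instance Definition _ := GRing.Zmodule.on quotmod.

Definition qpi (x : V) : quotmod := \pi_(Quotient.quot submod_zmodClosed)%qT x.
Definition qrepr (x : quotmod) : V := repr (x : Quotient.quot submod_zmodClosed).

Lemma qreprK : cancel qrepr qpi. Proof. exact: reprK. Qed.

Lemma qpi_eq x y : (qpi x = qpi y) <-> (x - y \in S).
Proof.
have -> : (x - y \in S) = (x - y \in GRing.ZmodClosed.sort submod_zmodClosed) by [].
by rewrite Quotient.idealrBE; split=> /eqP.
Qed.

Lemma qpi_repr x : qrepr (qpi x) - x \in S.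
Proof. by apply/qpi_eq; rewrite qreprK. Qed.

Fact qpiD : {morph qpi : x y / x + y}.
Proof. by move=> x y; rewrite /qpi piE. Qed.

Definition qscale (a : k) (x : quotmod) := qpi (a *: qrepr x).

Fact qscaleE a x : qscale a (qpi x) = qpi (a *: x).
Proof. by apply/qpi_eq; rewrite -scalerBr rpredZ ?qpi_repr. Qed.

Fact qscaleA a b x : qscale a (qscale b x) = qscale (a * b) x.
Proof. by rewrite -[x]qreprK !qscaleE scalerA. Qed.
Fact qscale1 : left_id 1 qscale.
Proof. by move=> x; rewrite -[x]qreprK !qscaleE scale1r. Qed.
Fact qscaleDr : right_distributive qscale +%R.
Proof.
by move=> a x y; rewrite -[x]qreprK -[y]qreprK -qpiD !qscaleE -qpiD scalerDr.
Qed.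
Fact qscaleDl x : {morph qscale^~ x : a b / a + b}.
Proof. by move=> a b; rewrite -[x]qreprK !qscaleE -qpiD scalerDl. Qed.

HB.instance Definition _ := GRing.Zmodule_isLmodule.Build k quotmod
  qscaleA qscale1 qscaleDr qscaleDl.

Fact qpi_linear : linear qpi.
Proof. by move=> a x y; rewrite qpiD -qscaleE. Qed.
HB.instance Definition _ := GRing.isLinear.Build k V quotmod _ qpi qpi_linear.

Lemma qpi_eq0 x : (qpi x = 0) <-> (x \in S).
Proof. by rewrite -(linear0 qpi) qpi_eq subr0. Qed.

Section Lift.
Variables (W : lmodType k) (f : V -> W).

Definition qlift (x : quotmod) : W := f (qrepr x).

Hypotheses (f_lin : linear f) (fS : forall x, x \in S -> f x = 0).

Lemma qliftE x : qlift (qpi x) = f x.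
Proof. by apply/eqP; rewrite -subr_eq0 -(linB f_lin) fS ?qpi_repr. Qed.

Lemma qlift_linear : linear qlift.
Proof.
move=> a x y; rewrite -[x]qreprK -[y]qreprK -qpi_linear !qliftE.
by rewrite f_lin.
Qed.
End Lift.
End QuotientModule.

Arguments qpi {k V} S x.

Section SubModule.
Variables (k : comPzRingType) (V : lmodType k) (S : submodClosed V).

Record submod := SubMod { submod_val :> V; _ : submod_val \in S }.
HB.instance Definition _ := [isSub of submod for submod_val].
HB.instance Definition _ := [Choice of submod by <:].
HB.instance Definition _ := [SubChoice_isSubLmodule of submod by <:].
End SubModule.
(* I is an arbitrary type: it is turned into a choiceType by {classic I} where
   decidable equality is needed. *)
Section DirectSum.
Variables (k : comPzRingType) (I : Type) (M : I -> lmodType k).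

Record dsum := DSum {
  dcoef :> forall i, M i;
  dcoef_fin : finite_set [set i | dcoef i != 0] }.

Lemma dsumP (x y : dsum) : (forall i, x i = y i) -> x = y.
Proof.
case: x y => [x xf] [y yf] /= exy.
have exy' : x = y by apply: functional_extensionality_dep.
by case: _ / exy' in yf *; congr DSum; exact: Prop_irrelevance.
Qed.

HB.instance Definition _ := gen_eqMixin dsum.
HB.instance Definition _ := gen_choiceMixin dsum.

Fact dzero_fin : finite_set [set i | (0 : M i) != 0].
Proof.
rewrite (_ : [set _ | _] = set0) //.
by apply/seteqP; split=> i //=; rewrite eqxx.
Qed.
Definition dzero := DSum dzero_fin.

Fact dopp_fin (x : dsum) : finite_set [set i | - x i != 0].
Proof. by apply: sub_finite_set (dcoef_fin x) => i /=; rewrite oppr_eq0. Qed.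
Definition dopp (x : dsum) := DSum (dopp_fin x).

Fact dadd_fin (x y : dsum) : finite_set [set i | x i + y i != 0].
Proof.
apply: (@sub_finite_set _ _ ([set i | x i != 0] `|` [set i | y i != 0])%classic).
  move=> i /=; case: (eqVneq (x i) 0) => [->|]; last by left.
  by rewrite add0r; right.
by rewrite finite_setU; split; exact: dcoef_fin.
Qed.
Definition dadd (x y : dsum) := DSum (dadd_fin x y).

Fact dscale_fin a (x : dsum) : finite_set [set i | a *: x i != 0].
Proof.
apply: sub_finite_set (dcoef_fin x) => i /=.
by apply: contraNneq => ->; rewrite scaler0.
Qed.
Definition dscale a (x : dsum) := DSum (dscale_fin a x).

Fact daddA : associative dadd.
Proof. by move=> x y z; apply: dsumP => i /=; rewrite addrA. Qed.
Fact daddC : commutative dadd.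
Proof. by move=> x y; apply: dsumP => i /=; rewrite addrC. Qed.
Fact dadd0 : left_id dzero dadd.
Proof. by move=> x; apply: dsumP => i /=; rewrite add0r. Qed.
Fact daddN : left_inverse dzero dopp dadd.
Proof. by move=> x; apply: dsumP => i /=; rewrite addNr. Qed.
HB.instance Definition _ := GRing.isZmodule.Build dsum daddA daddC dadd0 daddN.

Fact dscaleA a b x : dscale a (dscale b x) = dscale (a * b) x.
Proof. by apply: dsumP => i /=; rewrite scalerA. Qed.
Fact dscale1 : left_id 1 dscale.
Proof. by move=> x; apply: dsumP => i /=; rewrite scale1r. Qed.
Fact dscaleDr : right_distributive dscale +%R.
Proof. by move=> a x y; apply: dsumP => i /=; rewrite scalerDr. Qed.
Fact dscaleDl x : {morph dscale^~ x : a b / a + b}.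
Proof. by move=> a b; apply: dsumP => i /=; rewrite scalerDl. Qed.
HB.instance Definition _ := GRing.Zmodule_isLmodule.Build k dsum
  dscaleA dscale1 dscaleDr dscaleDl.

Lemma dcoef_linear i : linear (fun x : dsum => x i).
Proof. by []. Qed.

Definition din_fun i (x : M i) : forall j, M j :=
  @dfwith {classic I} M (fun=> 0) i x.

Fact din_fin i (x : M i) : finite_set [set j | din_fun x j != 0].
Proof.
apply: (@sub_finite_set _ _ [set i]) => // j /=.
case: (eqVneq (i : {classic I}) j) => [//|nij].
by rewrite /din_fun dfwith_out // eqxx.
Qed.
Definition din i (x : M i) := DSum (din_fin x).

Lemma din_in i (x : M i) : din x i = x.
Proof. by rewrite /= /din_fun dfwith_in. Qed.
Lemma din_out i (x : M i) j : i <> j -> din x j = 0.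
Proof. by move=> nij; rewrite /= /din_fun dfwith_out //; apply/eqP. Qed.

Fact din_linear i : linear (@din i).
Proof.
move=> a x y; apply: dsumP => j; rewrite dcoef_linear.
have [eij|nij] := pselect (i = j); last by rewrite !din_out // scaler0 addr0.
by case: _ / eij; rewrite !din_in.
Qed.
HB.instance Definition _ i := GRing.isLinear.Build k (M i) dsum _ (@din i) (@din_linear i).

Section Lift.
Variables (W : lmodType k) (f : forall i, M i -> W).

Definition dlift (x : dsum) : W := \sum_(i \in [set: {classic I}]) f (x i).

Hypothesis f_lin : forall i, linear (@f i).

Lemma dlift_widen (x : dsum) (A : set {classic I}) :
  ([set i | x i != 0] `<=` A)%classic -> dlift x = \sum_(i \in A) f (x i).
Proof.
move=> xA; rewrite /dlift; apply/esym/fsbig_widen => // i [_ /= nAi].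
have [->|nz] := eqVneq (x i) 0; first by rewrite /= lin0.
by case: nAi; apply: xA.
Qed.

Lemma dlift_linear : linear dlift.
Proof.
move=> a x y.
set A := ([set i : {classic I} | x i != 0] `|` [set i | y i != 0])%classic.
have Af : finite_set A by rewrite finite_setU; split; exact: dcoef_fin.
rewrite (@dlift_widen x A); last by move=> i; left.
rewrite (@dlift_widen y A); last by move=> i; right.
rewrite (@dlift_widen _ A); last first.
  move=> i /=; case: (eqVneq (x i) 0) => [->|]; last by left.
  by case: (eqVneq (y i) 0) => [->|]; [rewrite scaler0 addr0 eqxx | right].
rewrite !(fsbig_finite _ _ Af) /= scaler_sumr -big_split /=.
by apply: eq_bigr => i _; rewrite f_lin.
Qed.

Lemma dlift_in i (x : M i) : dlift (din x) = f x.
Proof.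
rewrite (@dlift_widen _ [set (i : {classic I})]) ?fsbig_set1 ?din_in // => j dj.
apply: contrapT => nij; case/negP: dj; apply/eqP; apply: din_out => eij.
by apply: nij; rewrite /= eij.
Qed.
End Lift.

Lemma dsum_sum (x : dsum) (A : set {classic I}) : finite_set A ->
  ([set i | x i != 0] `<=` A)%classic -> x = \sum_(i \in A) din (x i).
Proof.
move=> Af xA; apply: dsumP => j; rewrite fsbig_finite //.
rewrite (lin_sum (@dcoef_linear j)).
have [Aj|nAj] := pselect (A j); last first.
  rewrite big1_seq => [|i /= iA].
    by have [//|nz] := eqVneq (x j) 0; case: nAj; exact: xA.
  apply: din_out => eij; apply: nAj; case: _ / eij.
  by move: iA; rewrite in_fset_set // inE.
rewrite (bigD1_seq (j : {classic I})); last 2 first.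
- by rewrite in_fset_set // inE.
- exact: finmap.fset_uniq.
rewrite din_in big1 => [|i nij]; first by rewrite /= addr0.
by apply: din_out => eij; rewrite eij eqxx in nij.
Qed.

Lemma dsum_ext (W : lmodType k) (f g : dsum -> W) : linear f -> linear g ->
  (forall i x, f (@din i x) = g (din x)) -> f =1 g.
Proof.
move=> fl gl efg x.
rewrite (@dsum_sum x _ (dcoef_fin x) (fun=> id)) fsbig_finite; last first.
  exact: dcoef_fin.
by rewrite (lin_sum fl) (lin_sum gl); apply: eq_bigr => i _; exact: efg.
Qed.

End DirectSum.
Arguments din {k I M} i x.
Arguments dlift {k I M W} f x.

Section Free.
Variables (k : comPzRingType) (K : Type).

Definition freemod : lmodType k := dsum (fun _ : K => k^o).
Definition fgen (a : K) : freemod := @din k K (fun _ : K => k^o) a 1.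

Definition flift (W : lmodType k) (g : K -> W) : freemod -> W :=
  dlift (fun a (c : k^o) => (c : k) *: g a).

Fact flift_aux (W : lmodType k) (g : K -> W) (a : K) :
  linear (fun c : k^o => (c : k) *: g a).
Proof. by move=> c x y; rewrite scalerDl scalerA. Qed.

Lemma flift_linear W g : linear (@flift W g).
Proof. exact/dlift_linear/flift_aux. Qed.

Lemma flift_gen W g a : @flift W g (fgen a) = g a.
Proof. by rewrite /flift /fgen dlift_in ?scale1r //; exact: flift_aux. Qed.

Lemma free_ext (W : lmodType k) (f g : freemod -> W) : linear f -> linear g ->
  (forall a, f (fgen a) = g (fgen a)) -> f =1 g.
Proof.
move=> fl gl efg; apply: dsum_ext => // a c.
have -> : din a c = (c : k) *: fgen a :> freemod.
  by rewrite -[c in LHS]mulr1; exact: (linZ (@din_linear k K (fun=> k^o) a)).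
by rewrite !linZ // efg.
Qed.
End Free.
Arguments fgen {k K} a.
Arguments flift {k K W} g x.
Section Tensor.
Variables (k : comPzRingType) (M N : lmodType k).

(* tensor M N is the free module on M * N modulo bilinearity. *)
Inductive bilin_rel : set (freemod k (M * N)) :=
| BilinL a m m' n :
    bilin_rel (fgen (a *: m + m', n) - (a *: fgen (m, n) + fgen (m', n)))
| BilinR a m n n' :
    bilin_rel (fgen (m, a *: n + n') - (a *: fgen (m, n) + fgen (m, n'))).

Definition tensor : lmodType k := quotmod (span bilin_rel).
Definition tens (m : M) (n : N) : tensor := qpi (span bilin_rel) (fgen (m, n)).

Lemma tens_linl n : linear (tens^~ n).
Proof.
move=> a m m'; rewrite /tens -qpi_linear.
by apply/qpi_eq; apply: mem_span; constructor.
Qed.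

Lemma tens_linr m : linear (tens m).
Proof.
move=> a n n'; rewrite /tens -qpi_linear.
by apply/qpi_eq; apply: mem_span; constructor.
Qed.

Variable W : lmodType k.

Definition tlift (f : M -> N -> W) : tensor -> W :=
  qlift (flift (fun p : M * N => f p.1 p.2)).

Section TLift.
Variable f : M -> N -> W.
Hypotheses (f_linl : forall n, linear (f^~ n)) (f_linr : forall m, linear (f m)).

Fact tlift_kill (x : freemod k (M * N)) : x \in span bilin_rel ->
  flift (fun p : M * N => f p.1 p.2) x = 0.
Proof.
apply: span_ker => [|g]; first exact: flift_linear.
have fl := flift_linear (fun p : M * N => f p.1 p.2).
case=> [a m m' n|a m n n']; rewrite (linB fl) fl !flift_gen /=.
- by rewrite (f_linl n) subrr.
- by rewrite f_linr subrr.
Qed.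

Lemma tlift_tens m n : tlift f (tens m n) = f m n.
Proof.
rewrite /tlift /tens qliftE ?flift_gen //; [exact: flift_linear|exact: tlift_kill].
Qed.

Lemma tlift_linear : linear (tlift f).
Proof. by apply: qlift_linear; [exact: flift_linear|exact: tlift_kill]. Qed.
End TLift.

Lemma tensor_ext (f g : tensor -> W) : linear f -> linear g ->
  (forall m n, f (tens m n) = g (tens m n)) -> f =1 g.
Proof.
move=> fl gl efg x; rewrite -[x]qreprK.
have ql := @qpi_linear _ _ (span bilin_rel).
by apply: (free_ext (lin_comp fl ql) (lin_comp gl ql)) => -[m n]; exact: efg.
Qed.
End Tensor.
Arguments tens {k M N} m n.

(* A monad on X in matrices of k-modules, i.e. a k-linear category on X:
   [T y x] consists of the morphisms from x to y. *)
Record linmonad (k : comPzRingType) (X : Type) := LinMonad {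
  mhom :> X -> X -> lmodType k;
  mcomp : forall z y x, mhom z y -> mhom y x -> mhom z x;
  mid : forall x, mhom x x;
  mcomp_linl : forall z y x (g : mhom y x), linear (fun f : mhom z y => mcomp f g);
  mcomp_linr : forall z y x (f : mhom z y), linear (fun g : mhom y x => mcomp f g);
  mcompA : forall w z y x (f : mhom w z) (g : mhom z y) (h : mhom y x),
    mcomp f (mcomp g h) = mcomp (mcomp f g) h;
  mcomp1l : forall y x (f : mhom y x), mcomp (mid y) f = f;
  mcomp1r : forall y x (f : mhom y x), mcomp f (mid x) = f }.

Arguments mcomp {k X l z y x} f g : rename.
Arguments mid {k X l} x : rename.

Section Modules.
Variables (k : comPzRingType) (X : Type) (T : linmonad k X).

Record lmodule := LModule {
  mcar :> X -> lmodType k;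
  act : forall y x, T y x -> mcar x -> mcar y;
  act_linl : forall y x (v : mcar x), linear (fun f : T y x => act f v);
  act_linr : forall y x (f : T y x), linear (act f);
  actA : forall z y x (f : T z y) (g : T y x) (v : mcar x),
    act f (act g v) = act (mcomp f g) v;
  act1 : forall x (v : mcar x), act (mid x) v = v }.

Record modhom (M N : lmodule) := ModHom {
  mor :> forall x, M x -> N x;
  mor_linear : forall x, linear (@mor x);
  mor_act : forall y x (f : T y x) (v : M x), mor (act f v) = act f (mor v) }.

Lemma modhomP (M N : lmodule) (f g : modhom M N) :
  (forall x v, f x v = g x v) -> f = g.
Proof.
case: f g => [f fl fa] [g gl ga] /= efg.
have {}efg : f = g.
  apply: functional_extensionality_dep => x.
  by apply: functional_extensionality_dep => v; exact: efg.
case: _ / efg in gl ga *.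
by rewrite (Prop_irrelevance fl gl) (Prop_irrelevance fa ga).
Qed.

Definition modhom_id (M : lmodule) : modhom M M :=
  @ModHom M M (fun x v => v) (fun x a u v => erefl) (fun y x f v => erefl).

Section Comp.
Variables (M N P : lmodule) (g : modhom N P) (f : modhom M N).
Fact modhom_comp_linear x : linear (fun v : M x => g x (f x v)).
Proof. by move=> a u v; rewrite !mor_linear. Qed.
Fact modhom_comp_act y x (h : T y x) (v : M x) :
  g y (f y (act h v)) = act h (g x (f x v)).
Proof. by rewrite !mor_act. Qed.
Definition modhom_comp : modhom M P := ModHom modhom_comp_linear modhom_comp_act.
End Comp.

Section HomModule.
Variables M N : lmodule.

HB.instance Definition _ := gen_eqMixin (modhom M N).
HB.instance Definition _ := gen_choiceMixin (modhom M N).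

Fact mh0_linear x : linear (fun _ : M x => 0 : N x).
Proof. by move=> a u v; rewrite scaler0 addr0. Qed.
Fact mh0_act y x (h : T y x) (v : M x) : 0 = act h (0 : N x).
Proof. by rewrite (lin0 (act_linr h)). Qed.
Definition modhom0 : modhom M N := ModHom mh0_linear mh0_act.

Fact mhN_linear (f : modhom M N) x : linear (fun v : M x => - f x v).
Proof. by move=> a u v; rewrite mor_linear opprD scalerN. Qed.
Fact mhN_act (f : modhom M N) y x (h : T y x) (v : M x) :
  - f y (act h v) = act h (- f x v).
Proof. by rewrite mor_act -scaleN1r -(linZ (act_linr h)) scaleN1r. Qed.
Definition modhomN f : modhom M N := ModHom (mhN_linear f) (mhN_act f).

Fact mhD_linear (f g : modhom M N) x : linear (fun v : M x => f x v + g x v).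
Proof. by move=> a u v; rewrite !mor_linear scalerDr addrACA. Qed.
Fact mhD_act (f g : modhom M N) y x (h : T y x) (v : M x) :
  f y (act h v) + g y (act h v) = act h (f x v + g x v).
Proof. by rewrite !mor_act (linD (act_linr h)). Qed.
Definition modhomD f g : modhom M N := ModHom (mhD_linear f g) (mhD_act f g).

Fact mhZ_linear a (f : modhom M N) x : linear (fun v : M x => a *: f x v).
Proof. by move=> b u v; rewrite mor_linear scalerDr !scalerA mulrC. Qed.
Fact mhZ_act a (f : modhom M N) y x (h : T y x) (v : M x) :
  a *: f y (act h v) = act h (a *: f x v).
Proof. by rewrite mor_act (linZ (act_linr h)). Qed.
Definition modhomZ a f : modhom M N := ModHom (mhZ_linear a f) (mhZ_act a f).

Fact mhA : associative modhomD.
Proof. by move=> f g h; apply: modhomP => x v /=; rewrite addrA. Qed.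
Fact mhC : commutative modhomD.
Proof. by move=> f g; apply: modhomP => x v /=; rewrite addrC. Qed.
Fact mh0D : left_id modhom0 modhomD.
Proof. by move=> f; apply: modhomP => x v /=; rewrite add0r. Qed.
Fact mhND : left_inverse modhom0 modhomN modhomD.
Proof. by move=> f; apply: modhomP => x v /=; rewrite addNr. Qed.
HB.instance Definition _ := GRing.isZmodule.Build (modhom M N) mhA mhC mh0D mhND.

Fact mhZA a b f : modhomZ a (modhomZ b f) = modhomZ (a * b) f.
Proof. by apply: modhomP => x v /=; rewrite scalerA. Qed.
Fact mhZ1 : left_id 1 modhomZ.
Proof. by move=> f; apply: modhomP => x v /=; rewrite scale1r. Qed.
Fact mhZDr : right_distributive modhomZ +%R.
Proof. by move=> a f g; apply: modhomP => x v /=; rewrite scalerDr. Qed.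
Fact mhZDl f : {morph modhomZ^~ f : a b / a + b}.
Proof. by move=> a b; apply: modhomP => x v /=; rewrite scalerDl. Qed.
HB.instance Definition _ := GRing.Zmodule_isLmodule.Build k (modhom M N)
  mhZA mhZ1 mhZDr mhZDl.
End HomModule.
End Modules.

Arguments act {k X T l y x} f v : rename.
Arguments mor {k X T M N} m {x} v : rename.

Record bimodule (k : comPzRingType) (X Y : Type)
    (T : linmonad k X) (S : linmonad k Y) := Bimodule {
  bcar :> X -> Y -> lmodType k;
  lact : forall x' x y, T x' x -> bcar x y -> bcar x' y;
  ract : forall x y y', bcar x y -> S y y' -> bcar x y';
  lact_linl : forall x' x y (b : bcar x y), linear (fun f : T x' x => lact f b);
  lact_linr : forall x' x y (f : T x' x), linear (fun b : bcar x y => lact f b);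
  ract_linl : forall x y y' (s : S y y'), linear (fun b : bcar x y => ract b s);
  ract_linr : forall x y y' (b : bcar x y), linear (fun s : S y y' => ract b s);
  lactA : forall x'' x' x y (f : T x'' x') (g : T x' x) (b : bcar x y),
    lact f (lact g b) = lact (mcomp f g) b;
  lact1 : forall x y (b : bcar x y), lact (mid x) b = b;
  ractA : forall x y y' y'' (b : bcar x y) (s : S y y') (t : S y' y''),
    ract (ract b s) t = ract b (mcomp s t);
  ract1 : forall x y (b : bcar x y), ract b (mid y) = b;
  lractA : forall x' x y y' (f : T x' x) (b : bcar x y) (s : S y y'),
    ract (lact f b) s = lact f (ract b s) }.

Arguments lact {k X Y T S b x' x y} f b : rename.
Arguments ract {k X Y T S b x y y'} b s : rename.

Record category := Category {
  obj :> Type;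
  hom : obj -> obj -> Type;
  idm : forall a, hom a a;
  compm : forall a b c, hom b c -> hom a b -> hom a c;
  compmA : forall a b c d (h : hom c d) (g : hom b c) (f : hom a b),
    compm h (compm g f) = compm (compm h g) f;
  comp1m : forall a b (f : hom a b), compm (idm b) f = f;
  compm1 : forall a b (f : hom a b), compm f (idm a) = f }.

Arguments hom {c} a b : rename.
Arguments idm {c} a : rename.
Arguments compm {c a b d} g f : rename.

Record functor (C D : category) := Functor {
  fobj :> C -> D;
  fmap : forall a b, hom a b -> hom (fobj a) (fobj b);
  fmap1 : forall a, fmap (idm a) = idm (fobj a);
  fmapM : forall a b c (g : hom b c) (f : hom a b),
    fmap (compm g f) = compm (fmap g) (fmap f) }.

Arguments fmap {C D} F {a b} f : rename.

Record adjunction (C D : category) (L : functor C D) (R : functor D C) := Adjunction {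
  adj :> forall a b, hom (L a) b -> hom a (R b);
  adj_bij : forall a b, bijective (@adj a b);
  adj_natl : forall a' a b (u : hom a' a) (f : hom (L a) b),
    adj (compm f (fmap L u)) = compm (adj f) u;
  adj_natr : forall a b b' (v : hom b b') (f : hom (L a) b),
    adj (compm v f) = compm (fmap R v) (adj f) }.

Arguments adj {C D L R} a0 {a b} f : rename.

Section ModuleCategory.
Variables (k : comPzRingType) (X : Type) (T : linmonad k X).

Fact modhom_compA (M N P Q : lmodule T)
    (h : modhom P Q) (g : modhom N P) (f : modhom M N) :
  modhom_comp h (modhom_comp g f) = modhom_comp (modhom_comp h g) f.
Proof. exact: modhomP. Qed.
Fact modhom_comp1l (M N : lmodule T) (f : modhom M N) :
  modhom_comp (modhom_id N) f = f.
Proof. exact: modhomP. Qed.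
Fact modhom_comp1r (M N : lmodule T) (f : modhom M N) :
  modhom_comp f (modhom_id M) = f.
Proof. exact: modhomP. Qed.

Definition Mod : category :=
  @Category (lmodule T) (@modhom k X T) (@modhom_id k X T) (@modhom_comp k X T)
    modhom_compA modhom_comp1l modhom_comp1r.
End ModuleCategory.

Section TensorHom.
Variables (k : comPzRingType) (X Y : Type) (T : linmonad k X) (S : linmonad k Y).
Variable B : bimodule T S.

Definition bimod_col (y : Y) : lmodule T :=
  @LModule k X T (fun x => B x y) (fun x' x f b => lact f b)
    (fun x' x b => lact_linl b) (fun x' x f => @lact_linr _ _ _ _ _ B x' x y f)
    (fun x'' x' x f g b => lactA f g b) (fun x b => lact1 b).

Section BTensor.
Variable N : lmodule S.

Section AtX.
Variable x : X.

(* (B (x)_S N)(x): the direct sum over y of B x y (x) N y, modulo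
   (b <| s) (x) v - b (x) (s |> v). *)
Definition bt_sum : lmodType k := dsum (fun y : Y => tensor (B x y) (N y)).

Inductive balanced_rel : set bt_sum :=
| Balanced y y' (b : B x y) (s : S y y') (v : N y') :
    balanced_rel (din y' (tens (ract b s) v) - din y (tens b (act s v))).

Definition btensor : lmodType k := quotmod (span balanced_rel).
Definition btens (y : Y) (b : B x y) (v : N y) : btensor :=
  qpi (span balanced_rel) (din y (tens b v)).

Lemma btens_linl y (v : N y) : linear (fun b : B x y => btens b v).
Proof. by move=> a b b'; rewrite /btens tens_linl din_linear qpi_linear. Qed.
Lemma btens_linr y (b : B x y) : linear (fun v : N y => btens b v).
Proof. by move=> a v v'; rewrite /btens tens_linr din_linear qpi_linear. Qed.

Lemma btens_balanced y y' (b : B x y) (s : S y y') (v : N y') :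
  btens (ract b s) v = btens b (act s v).
Proof. by apply/qpi_eq; apply: mem_span; constructor. Qed.

Section BLift.
Variables (W : lmodType k) (f : forall y, B x y -> N y -> W).

Definition blift : btensor -> W := qlift (dlift (fun y => tlift (@f y))).

Hypotheses (f_linl : forall y (v : N y), linear (fun b => f b v))
  (f_linr : forall y (b : B x y), linear (f b))
  (f_bal : forall y y' (b : B x y) (s : S y y') (v : N y'),
     f (ract b s) v = f b (act s v)).

Let f_tlin y : linear (tlift (@f y)).
Proof. by apply: tlift_linear; [exact: f_linl | exact: f_linr]. Qed.
Let f_lin : linear (dlift (fun y => tlift (@f y))).
Proof. exact: dlift_linear. Qed.

Fact blift_kill z : z \in span balanced_rel -> dlift (fun y => tlift (@f y)) z = 0.
Proof.
apply: span_ker => // _ [y y' b s v]; rewrite (linB f_lin) !dlift_in //.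
rewrite !tlift_tens //.
by rewrite f_bal subrr.
Qed.

Lemma blift_btens y (b : B x y) (v : N y) : blift (btens b v) = f b v.
Proof.
rewrite /blift /btens qliftE //; last exact: blift_kill.
by rewrite dlift_in // tlift_tens.
Qed.

Lemma blift_linear : linear blift.
Proof. by apply: qlift_linear => //; exact: blift_kill. Qed.
End BLift.

Lemma btensor_ext (W : lmodType k) (f g : btensor -> W) : linear f -> linear g ->
  (forall y (b : B x y) (v : N y), f (btens b v) = g (btens b v)) -> f =1 g.
Proof.
move=> fl gl efg z; rewrite -[z]qreprK.
have ql := @qpi_linear _ _ (span balanced_rel).
have fql := lin_comp fl ql; have gql := lin_comp gl ql.
apply: (dsum_ext fql gql) => y t.
have dl := @din_linear _ _ (fun y : Y => tensor (B x y) (N y)) y.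
by apply: (tensor_ext (lin_comp fql dl) (lin_comp gql dl)) => b v; exact: efg.
Qed.
End AtX.

Definition bt_act (x' x : X) (t : T x' x) : btensor x -> btensor x' :=
  blift (fun y (b : B x y) (v : N y) => btens (lact t b) v).

Lemma bt_act_linr x' x (t : T x' x) : linear (bt_act t).
Proof.
apply: blift_linear => [y v|y b|y y' b s v].
- by move=> a b b'; rewrite lact_linr btens_linl.
- exact: btens_linr.
- by rewrite -btens_balanced lractA.
Qed.

Lemma bt_actE x' x (t : T x' x) y (b : B x y) (v : N y) :
  bt_act t (btens b v) = btens (lact t b) v.
Proof.
apply: blift_btens => {b v} [y' v|y' b|y1 y2 b s v].
- by move=> a b b'; rewrite lact_linr btens_linl.
- exact: btens_linr.
- by rewrite -btens_balanced lractA.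
Qed.

Lemma bt_act_linl x' x (z : btensor x) : linear (fun t : T x' x => bt_act t z).
Proof.
move=> a t t'; move: z; apply: btensor_ext.
- exact: bt_act_linr.
- by move=> c u v; rewrite !bt_act_linr !scalerDr !scalerA (mulrC a) addrACA.
- by move=> y b v; rewrite !bt_actE lact_linl btens_linl.
Qed.

Lemma bt_actA x'' x' x (f : T x'' x') (g : T x' x) (z : btensor x) :
  bt_act f (bt_act g z) = bt_act (mcomp f g) z.
Proof.
move: z; apply: btensor_ext.
- by apply: (lin_comp (f := bt_act f)); exact: bt_act_linr.
- exact: bt_act_linr.
- by move=> y b v; rewrite !bt_actE lactA.
Qed.

Lemma bt_act1 x (z : btensor x) : bt_act (mid x) z = z.
Proof.
move: z; apply: btensor_ext => //; first exact: bt_act_linr.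
by move=> y b v; rewrite !bt_actE lact1.
Qed.

Definition tensor_obj : lmodule T :=
  @LModule k X T btensor bt_act bt_act_linl bt_act_linr bt_actA bt_act1.
End BTensor.

Section BTensorMap.
Variables (N P : lmodule S) (phi : modhom N P).

Definition bt_map x : btensor N x -> btensor P x :=
  blift (fun y (b : B x y) (v : N y) => btens b (phi y v)).

Lemma bt_map_linear x : linear (@bt_map x).
Proof.
apply: blift_linear => [y v|y b|y y' b s v].
- exact: btens_linl.
- by move=> a v v'; rewrite mor_linear btens_linr.
- by rewrite mor_act btens_balanced.
Qed.

Lemma bt_mapE x y (b : B x y) (v : N y) : bt_map (btens b v) = btens b (phi y v).
Proof.
apply: blift_btens => {b v} [y' v|y' b|y1 y2 b s v].
- exact: btens_linl.
- by move=> a v v'; rewrite mor_linear btens_linr.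
- by rewrite mor_act btens_balanced.
Qed.

Lemma bt_map_act x' x (t : T x' x) (z : btensor N x) :
  bt_map (bt_act t z) = bt_act t (bt_map z).
Proof.
move: z; apply: btensor_ext.
- by apply: (lin_comp (f := @bt_map x')); [exact: bt_map_linear | exact: bt_act_linr].
- by apply: (lin_comp (f := bt_act t)); [exact: bt_act_linr | exact: bt_map_linear].
- by move=> y b v; rewrite !(bt_actE, bt_mapE).
Qed.

Definition tensor_map : modhom (tensor_obj N) (tensor_obj P) :=
  @ModHom k X T (tensor_obj N) (tensor_obj P) bt_map bt_map_linear bt_map_act.
End BTensorMap.

Fact tensor_map1 N : tensor_map (modhom_id N) = modhom_id (tensor_obj N).
Proof.
apply: modhomP => x; apply: btensor_ext => //; first exact: bt_map_linear.
by move=> y b v; rewrite /= bt_mapE.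
Qed.

Fact tensor_mapM N P Q (g : modhom P Q) (f : modhom N P) :
  tensor_map (modhom_comp g f) = modhom_comp (tensor_map g) (tensor_map f).
Proof.
apply: modhomP => x; apply: btensor_ext; first exact: bt_map_linear.
  by apply: (lin_comp (f := @bt_map _ _ g x)); exact: bt_map_linear.
by move=> y b v; rewrite /= !bt_mapE.
Qed.

Definition tensor_functor : functor (Mod S) (Mod T) :=
  @Functor (Mod S) (Mod T) tensor_obj tensor_map tensor_map1 tensor_mapM.

(* Hom_T(B, M)(y) is the module of T-module maps B(-, y) -> M,
   with (s |> phi)(b) = phi(b <| s). *)
Section HomObj.
Variable M : lmodule T.

Section HomAct.
Variables (y y' : Y) (s : S y y') (phi : modhom (bimod_col y') M).

Fact hom_act_linear x : linear (fun b : bimod_col y x => phi x (ract (b : B x y) s)).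
Proof. by move=> a b b'; rewrite ract_linl mor_linear. Qed.

Fact hom_act_act x' x (f : T x' x) (b : bimod_col y x) :
  phi x' (ract (act f b : B x' y) s) = act f (phi x (ract (b : B x y) s)).
Proof. by rewrite -mor_act /= lractA. Qed.

Definition hom_act : modhom (bimod_col y) M :=
  @ModHom k X T (bimod_col y) M (fun x b => phi x (ract (b : B x y) s))
    hom_act_linear hom_act_act.
End HomAct.

Fact hom_act_linl y y' (phi : modhom (bimod_col y') M) :
  linear (fun s : S y y' => hom_act s phi).
Proof.
move=> a s s'; apply: modhomP => x b.
by rewrite /= ract_linr mor_linear.
Qed.
Fact hom_act_linr y y' (s : S y y') : linear (hom_act s).
Proof. by move=> a f g; apply: modhomP. Qed.
Fact hom_actA y'' y' y (s : S y'' y') (t : S y' y) (phi : modhom (bimod_col y) M) :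
  hom_act s (hom_act t phi) = hom_act (mcomp s t) phi.
Proof. by apply: modhomP => x b; rewrite /= ractA. Qed.
Fact hom_act1 y (phi : modhom (bimod_col y) M) : hom_act (mid y) phi = phi.
Proof. by apply: modhomP => x b; rewrite /= ract1. Qed.

Definition hom_obj : lmodule S :=
  @LModule k Y S (fun y => modhom (bimod_col y) M : lmodType k)
    hom_act hom_act_linl hom_act_linr hom_actA hom_act1.
End HomObj.

Section HomMap.
Variables (M N : lmodule T) (psi : modhom M N).

Fact hom_map_linear y : linear (fun phi : hom_obj M y => modhom_comp psi phi : hom_obj N y).
Proof. by move=> a f g; apply: modhomP => x b; rewrite /= mor_linear. Qed.
Fact hom_map_act y' y (s : S y' y) (phi : hom_obj M y) :
  modhom_comp psi (act s phi) = act s (modhom_comp psi phi : hom_obj N y).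
Proof. by apply: modhomP. Qed.
Definition hom_map : modhom (hom_obj M) (hom_obj N) :=
  @ModHom k Y S (hom_obj M) (hom_obj N) (fun y phi => modhom_comp psi phi)
    hom_map_linear hom_map_act.
End HomMap.

Fact hom_map1 M : hom_map (modhom_id M) = modhom_id (hom_obj M).
Proof. by apply: modhomP => y phi; apply: modhomP. Qed.
Fact hom_mapM M N P (g : modhom N P) (f : modhom M N) :
  hom_map (modhom_comp g f) = modhom_comp (hom_map g) (hom_map f).
Proof. by apply: modhomP => y phi; apply: modhomP. Qed.

Definition hom_functor : functor (Mod T) (Mod S) :=
  @Functor (Mod T) (Mod S) hom_obj hom_map hom_map1 hom_mapM.

(* The adjunct of f : B (x)_S N -> M is v |-> (b |-> f (b (x) v)). *)
Definition is_tensor_hom (A : adjunction tensor_functor hom_functor) : Prop :=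
  forall (N : lmodule S) (M : lmodule T) (f : modhom (tensor_obj N) M)
    y (v : N y) x (b : B x y),
  let g : modhom N (hom_obj M) := adj A f in
  mor (g y v : modhom (bimod_col y) M) b = mor f (btens b v).
End TensorHom.
Section Eigenmonad.
Variables (k : comPzRingType) (X : Type) (T : linmonad k X).

Record left_ideal := LeftIdeal {
  lideal :> forall y x, submodClosed (T y x);
  lideal_comp : forall z y x (f : T z y) (g : T y x),
    g \in lideal y x -> mcomp f g \in lideal z x }.

(* gen_left_ideal G is the intersection of the left ideals containing G. *)
Section Generated.
Variable G : forall y x, set (T y x).

Definition gen_pred y x : {pred T y x} :=
  fun f => `[< forall J : left_ideal,
    (forall z w (g : T z w), G g -> g \in J z w) -> f \in J y x >].

Fact gen_submod y x : subsemimod_closed (@gen_pred y x).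
Proof.
split; first split.
- by apply/asboolP => J _; exact: rpred0.
- move=> f g /asboolP Gf /asboolP Gg; apply/asboolP => J GJ.
  by apply: rpredD; [exact: Gf | exact: Gg].
- move=> a f /asboolP Gf; apply/asboolP => J GJ; apply: rpredZ; exact: Gf.
Qed.
HB.instance Definition _ y x :=
  GRing.isSubmodClosed.Build k (T y x) (@gen_pred y x) (@gen_submod y x).

Fact gen_comp z y x (f : T z y) (g : T y x) :
  g \in gen_pred (x := x) -> mcomp f g \in gen_pred (x := x).
Proof.
move=> /asboolP Gg; apply/asboolP => J GJ; apply: lideal_comp; exact: Gg.
Qed.

Definition gen_left_ideal : left_ideal :=
  @LeftIdeal (fun y x => gen_pred (y := y) (x := x)) gen_comp.
End Generated.

Variable J : left_ideal.

Definition idealizer y x : {pred T y x} :=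
  fun f => `[< forall z (g : T z y), g \in J z y -> mcomp g f \in J z x >].

Fact idealizer_submod y x : subsemimod_closed (@idealizer y x).
Proof.
split; first split.
- by apply/asboolP => z g _; rewrite (lin0 (mcomp_linr g)) rpred0.
- move=> f h /asboolP If /asboolP Ih; apply/asboolP => z g Jg.
  by rewrite (linD (mcomp_linr g)) rpredD ?If ?Ih.
- move=> a f /asboolP If; apply/asboolP => z g Jg.
  by rewrite (linZ (mcomp_linr g)) rpredZ ?If.
Qed.
HB.instance Definition _ y x :=
  GRing.isSubmodClosed.Build k (T y x) (@idealizer y x) (@idealizer_submod y x).

Definition Iz y x : lmodType k := submod (idealizer (y := y) (x := x)).

Lemma IzP y x (f : Iz y x) z (g : T z y) :
  g \in J z y -> mcomp g (submod_val f) \in J z x.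
Proof. by case: f => f /= /asboolP; apply. Qed.

Fact Iz_comp_subproof z y x (f : Iz z y) (g : Iz y x) :
  mcomp (submod_val f) (submod_val g) \in idealizer (x := x).
Proof. by apply/asboolP => w h Jh; rewrite mcompA; do 2!apply: IzP. Qed.
Definition Iz_comp z y x (f : Iz z y) (g : Iz y x) : Iz z x :=
  SubMod (Iz_comp_subproof f g).

Fact Iz_id_subproof x : mid x \in @idealizer x x.
Proof. by apply/asboolP => z g; rewrite mcomp1r. Qed.
Definition Iz_id x : Iz x x := SubMod (Iz_id_subproof x).

(* J as a (two-sided) ideal of Iz. *)
Definition Iz_ideal y x : {pred Iz y x} := fun f => submod_val f \in J y x.

Fact Iz_ideal_submod y x : subsemimod_closed (@Iz_ideal y x).
Proof.
split; first split.
- exact: rpred0.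
- by move=> f g Jf Jg; rewrite unfold_in rpredD.
- by move=> a f Jf; rewrite unfold_in rpredZ.
Qed.
HB.instance Definition _ y x :=
  GRing.isSubmodClosed.Build k (Iz y x) (@Iz_ideal y x) (@Iz_ideal_submod y x).

Definition eigen_hom y x : lmodType k := quotmod (@Iz_ideal y x : submodClosed (Iz y x)).
Definition eigen_pi y x (f : Iz y x) : eigen_hom y x := qpi _ f.

Definition eigen_comp z y x (f : eigen_hom z y) (g : eigen_hom y x) : eigen_hom z x :=
  eigen_pi (Iz_comp (qrepr f) (qrepr g)).

Lemma Jcomp_congr z y x (f f' : T z y) (g g' : T y x) :
  (forall z (h : T z y), h \in J z y -> mcomp h g \in J z x) ->
  f - f' \in J z y -> g - g' \in J y x -> mcomp f g - mcomp f' g' \in J z x.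
Proof.
move=> Ig Jf Jg.
have -> : mcomp f g - mcomp f' g' = mcomp (f - f') g + mcomp f' (g - g').
  by rewrite (linB (mcomp_linl g)) (linB (mcomp_linr f')) addrA subrK.
by rewrite rpredD ?Ig // lideal_comp.
Qed.

Lemma eigen_pi_repr y x (f : Iz y x) :
  submod_val (qrepr (eigen_pi f)) - submod_val f \in J y x.
Proof.
have : qrepr (eigen_pi f) - f \in @Iz_ideal y x by exact: qpi_repr.
by [].
Qed.

Lemma eigen_compE z y x (f : Iz z y) (g : Iz y x) :
  eigen_comp (eigen_pi f) (eigen_pi g) = eigen_pi (Iz_comp f g).
Proof.
apply/qpi_eq; rewrite unfold_in /Iz_ideal /=.
by apply: Jcomp_congr; [exact: IzP | exact: eigen_pi_repr | exact: eigen_pi_repr].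
Qed.

Lemma eigenP y x (f : eigen_hom y x) : exists g, f = eigen_pi g.
Proof. by exists (qrepr f); rewrite /eigen_pi qreprK. Qed.

Fact eigen_pi_linear y x : linear (@eigen_pi y x).
Proof. exact: qpi_linear. Qed.

Fact eigen_comp_linl z y x (g : eigen_hom y x) :
  linear (fun f : eigen_hom z y => eigen_comp f g).
Proof.
move=> a f f'; have [[f0 ->] [f1 ->] [g0 ->]] := And3 (eigenP f) (eigenP f') (eigenP g).
rewrite -eigen_pi_linear !eigen_compE -eigen_pi_linear; congr eigen_pi.
by apply: val_inj; rewrite /= mcomp_linl.
Qed.
Fact eigen_comp_linr z y x (f : eigen_hom z y) :
  linear (fun g : eigen_hom y x => eigen_comp f g).
Proof.
move=> a g g'; have [[g0 ->] [g1 ->] [f0 ->]] := And3 (eigenP g) (eigenP g') (eigenP f).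
rewrite -eigen_pi_linear !eigen_compE -eigen_pi_linear; congr eigen_pi.
by apply: val_inj; rewrite /= mcomp_linr.
Qed.
Fact eigen_compA w z y x (f : eigen_hom w z) (g : eigen_hom z y) (h : eigen_hom y x) :
  eigen_comp f (eigen_comp g h) = eigen_comp (eigen_comp f g) h.
Proof.
have [[f0 ->] [g0 ->] [h0 ->]] := And3 (eigenP f) (eigenP g) (eigenP h).
rewrite !eigen_compE; congr eigen_pi.
by apply: val_inj; rewrite /= mcompA.
Qed.
Fact eigen_comp1l y x (f : eigen_hom y x) : eigen_comp (eigen_pi (Iz_id y)) f = f.
Proof.
have [f0 ->] := eigenP f; rewrite eigen_compE; congr eigen_pi.
by apply: val_inj; rewrite /= mcomp1l.
Qed.
Fact eigen_comp1r y x (f : eigen_hom y x) : eigen_comp f (eigen_pi (Iz_id x)) = f.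
Proof.
have [f0 ->] := eigenP f; rewrite eigen_compE; congr eigen_pi.
by apply: val_inj; rewrite /= mcomp1r.
Qed.

Definition eigenmonad : linmonad k X :=
  @LinMonad k X eigen_hom eigen_comp (fun x => eigen_pi (Iz_id x))
    eigen_comp_linl eigen_comp_linr eigen_compA eigen_comp1l eigen_comp1r.

Definition quot_hom y x : lmodType k := quotmod (J y x).
Definition quot_pi y x (f : T y x) : quot_hom y x := qpi _ f.

Lemma quotP y x (f : quot_hom y x) : exists g, f = quot_pi g.
Proof. by exists (qrepr f); rewrite /quot_pi qreprK. Qed.

Fact quot_pi_linear y x : linear (@quot_pi y x).
Proof. exact: qpi_linear. Qed.

Definition quot_lact z y x (f : T z y) (g : quot_hom y x) : quot_hom z x :=
  quot_pi (mcomp f (qrepr g)).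
Definition quot_ract z y x (f : quot_hom z y) (g : eigenmonad y x) : quot_hom z x :=
  quot_pi (mcomp (qrepr f) (submod_val (qrepr g))).

Lemma quot_lactE z y x (f : T z y) (g : T y x) :
  quot_lact f (quot_pi g) = quot_pi (mcomp f g).
Proof.
by apply/qpi_eq; rewrite -(linB (mcomp_linr f)) lideal_comp ?qpi_repr.
Qed.
Lemma quot_ractE z y x (f : T z y) (g : Iz y x) :
  quot_ract (quot_pi f) (eigen_pi g) = quot_pi (mcomp f (submod_val g)).
Proof.
apply/qpi_eq; apply: Jcomp_congr; first exact: IzP.
- exact: qpi_repr.
- exact: eigen_pi_repr.
Qed.

Fact quot_lact_linl z y x (g : quot_hom y x) : linear (fun f : T z y => quot_lact f g).
Proof.
have [g0 ->] := quotP g; move=> a f f'.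
by rewrite !quot_lactE -quot_pi_linear mcomp_linl.
Qed.
Fact quot_lact_linr z y x (f : T z y) : linear (fun g : quot_hom y x => quot_lact f g).
Proof.
move=> a g g'; have [[g0 ->] [g1 ->]] := conj (quotP g) (quotP g').
by rewrite -quot_pi_linear !quot_lactE -quot_pi_linear mcomp_linr.
Qed.
Fact quot_ract_linl z y x (g : eigenmonad y x) :
  linear (fun f : quot_hom z y => quot_ract f g).
Proof.
move=> a f f'; have [[f0 ->] [f1 ->] [g0 ->]] := And3 (quotP f) (quotP f') (eigenP g).
by rewrite -quot_pi_linear !quot_ractE -quot_pi_linear mcomp_linl.
Qed.
Fact quot_ract_linr z y x (f : quot_hom z y) :
  linear (fun g : eigenmonad y x => quot_ract f g).
Proof.
move=> a g g'; have [[g0 ->] [g1 ->] [f0 ->]] := And3 (eigenP g) (eigenP g') (quotP f).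
by rewrite -eigen_pi_linear !quot_ractE -quot_pi_linear -mcomp_linr.
Qed.
Fact quot_lactA w z y x (f : T w z) (g : T z y) (b : quot_hom y x) :
  quot_lact f (quot_lact g b) = quot_lact (mcomp f g) b.
Proof. by have [b0 ->] := quotP b; rewrite !quot_lactE mcompA. Qed.
Fact quot_lact1 y x (b : quot_hom y x) : quot_lact (mid y) b = b.
Proof. by have [b0 ->] := quotP b; rewrite !quot_lactE mcomp1l. Qed.
Fact quot_ractA w z y x (b : quot_hom w z) (s : eigenmonad z y) (t : eigenmonad y x) :
  quot_ract (quot_ract b s) t = quot_ract b (mcomp s t).
Proof.
have [[b0 ->] [s0 ->] [t0 ->]] := And3 (quotP b) (eigenP s) (eigenP t).
by rewrite /= eigen_compE !quot_ractE /= mcompA.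
Qed.
Fact quot_ract1 y x (b : quot_hom y x) : quot_ract b (mid x) = b.
Proof. by have [b0 ->] := quotP b; rewrite quot_ractE /= mcomp1r. Qed.
Fact quot_lractA w z y x (f : T w z) (b : quot_hom z y) (s : eigenmonad y x) :
  quot_ract (quot_lact f b) s = quot_lact f (quot_ract b s).
Proof.
have [[b0 ->] [s0 ->]] := conj (quotP b) (eigenP s).
by rewrite !(quot_lactE, quot_ractE) mcompA.
Qed.

Definition quot_bimod : bimodule T eigenmonad :=
  @Bimodule k X X T eigenmonad quot_hom quot_lact quot_ract
    quot_lact_linl quot_lact_linr quot_ract_linl quot_ract_linr
    quot_lactA quot_lact1 quot_ractA quot_ract1 quot_lractA.

End Eigenmonad.

(* [chom m n] consists of the morphisms m -> n. The finite products are given by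
   exhibiting n as the n-fold power of 1, with projections [cproj i]; the object
   0 is then terminal, m + n is the product of m and n with projections cfst and
   csnd, and n_1 + ... + n_d is the product of the n_i with projections cbigproj
   (see cterm_uniq, cfst_pair, csnd_pair, cpair_uniq, cbigproj_tuple,
   cbigtuple_uniq below). These products are strictly associative and unital, as
   addition is; [cproj_id] is the strictness of the one-factor product. *)
Record lawvere := Lawvere {
  chom :> nat -> nat -> Type;
  cid : forall n, chom n n;
  ccomp : forall l m n, chom m n -> chom l m -> chom l n;
  ccompA : forall p l m n (h : chom m n) (g : chom l m) (f : chom p l),
    ccomp h (ccomp g f) = ccomp (ccomp h g) f;
  ccomp1l : forall m n (f : chom m n), ccomp (cid n) f = f;
  ccomp1r : forall m n (f : chom m n), ccomp f (cid m) = f;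
  cproj : forall n, 'I_n -> chom n 1;
  ctuple : forall m n, ('I_n -> chom m 1) -> chom m n;
  cproj_tuple : forall m n (f : 'I_n -> chom m 1) (i : 'I_n),
    ccomp (cproj i) (ctuple f) = f i;
  ctuple_proj : forall m n (f : chom m n), ctuple (fun i => ccomp (cproj i) f) = f;
  cproj_id : cproj (ord0 : 'I_1) = cid 1 }.

Arguments cid {l} n : rename.
Arguments ccomp {l0 l m n} g f : rename.
Arguments cproj {l n} i : rename.
Arguments ctuple {l m n} f : rename.

Section FiniteProducts.
Variable C : lawvere.

Lemma chom_ext m n (f g : C m n) :
  (forall i, ccomp (cproj i) f = ccomp (cproj i) g) -> f = g.
Proof.
move=> efg; rewrite -[f]ctuple_proj -[g]ctuple_proj; congr ctuple.
exact: functional_extensionality_dep.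
Qed.

Definition cterm n : C n 0 :=
  ctuple (fun i : 'I_0 => False_rect (C n 1) (notF (ltn_ord i))).
Lemma cterm_uniq n (f : C n 0) : f = cterm n.
Proof. by apply: chom_ext => -[]. Qed.

Definition cfst m n : C (m + n) m := ctuple (fun i : 'I_m => cproj (lshift n i)).
Definition csnd m n : C (m + n) n := ctuple (fun i : 'I_n => cproj (rshift m i)).
Definition cpair l m n (f : C l m) (g : C l n) : C l (m + n) :=
  ctuple (fun i : 'I_(m + n) => match fintype.split i with
    | inl j => ccomp (cproj j) f
    | inr j => ccomp (cproj j) g
    end).

Lemma cfst_pair l m n (f : C l m) (g : C l n) : ccomp (cfst m n) (cpair f g) = f.
Proof.
apply: chom_ext => i; rewrite ccompA !cproj_tuple.
by rewrite (fintype.unsplitK (inl i : 'I_m + 'I_n)).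
Qed.
Lemma csnd_pair l m n (f : C l m) (g : C l n) : ccomp (csnd m n) (cpair f g) = g.
Proof.
apply: chom_ext => i; rewrite ccompA !cproj_tuple.
by rewrite (fintype.unsplitK (inr i : 'I_m + 'I_n)).
Qed.
Lemma cpair_uniq l m n (h : C l (m + n)) :
  cpair (ccomp (cfst m n) h) (ccomp (csnd m n) h) = h.
Proof.
apply: chom_ext => i; rewrite cproj_tuple.
rewrite -[in RHS](fintype.splitK i).
by case: fintype.splitP => j _; rewrite ccompA cproj_tuple.
Qed.

Definition ctimes m n m' n' (f : C m m') (g : C n n') : C (m + n) (m' + n') :=
  cpair (ccomp f (cfst m n)) (ccomp g (csnd m n)).

Definition cbigproj d (n : 'I_d -> nat) (i : 'I_d) : C (\sum_j n j)%N (n i) :=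
  ctuple (fun j : 'I_(n i) => cproj (tagnat.Rank i j)).
Definition cbigtuple d (n : 'I_d -> nat) l (f : forall i, C l (n i)) :
    C l (\sum_i n i)%N :=
  ctuple (fun s : 'I_(\sum_i n i)%N =>
    ccomp (cproj (tagnat.sig2 s)) (f (tagnat.sig1 s))).
Definition cbigtimes d (m n : 'I_d -> nat) (f : forall i, C (m i) (n i)) :
    C (\sum_i m i)%N (\sum_i n i)%N :=
  cbigtuple (fun i => ccomp (f i) (cbigproj m i)).

Lemma cbigproj_tuple d (n : 'I_d -> nat) l (f : forall i, C l (n i)) i :
  ccomp (cbigproj n i) (cbigtuple f) = f i.
Proof.
apply: chom_ext => j; rewrite ccompA !cproj_tuple.
pose G (p : {i : 'I_d & 'I_(n i)}) := ccomp (cproj (tagged p)) (f (tag p)).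
by rewrite -/(G (tagnat.sig (tagnat.Rank i j))) tagnat.rankK.
Qed.
Lemma cbigtuple_uniq d (n : 'I_d -> nat) l (h : C l (\sum_i n i)%N) :
  cbigtuple (fun i => ccomp (cbigproj n i) h) = h.
Proof.
apply: chom_ext => s; rewrite cproj_tuple ccompA cproj_tuple.
by rewrite tagnat.sig2K.
Qed.

(* Transport along equalities of objects: addition is associative only up to a
   propositional equality. *)
Definition ccast m m' n n' (em : m = m') (en : n = n') (f : C m n) : C m' n' :=
  ecast p (C p n') em (ecast q (C m q) en f).

Definition cdiag : C 1 2 := cpair (cid 1) (cid 1).

(* The choice of the zero object is immaterial: it is unique up to a unique
   isomorphism, and zero_mor does not depend on it. *)
Record zero_object := ZeroObject {
  zobj : nat;
  zfrom : forall n, C zobj n;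
  zto : forall n, C n zobj;
  zfrom_uniq : forall n (f : C zobj n), f = zfrom n;
  zto_uniq : forall n (f : C n zobj), f = zto n }.

Definition zero_mor (Z : zero_object) m n : C m n := ccomp (zfrom Z n) (zto Z m).

Record monoid_object := MonoidObject {
  omul : C 2 1;
  oone : C 0 1;
  omulA : ccomp omul (ctimes omul (cid 1) : C 3 2) =
          ccomp omul (ctimes (cid 1) omul : C 3 2);
  omul1l : ccomp omul (ctimes oone (cid 1) : C 1 2) = cid 1;
  omul1r : ccomp omul (ctimes (cid 1) oone : C 1 2) = cid 1 }.

(* The monoid structure on C(n, 1) induced by mu. *)
Definition cmul (mu : monoid_object) n (f g : C n 1) : C n 1 :=
  ccomp (omul mu) (cpair f g).
Definition cone (mu : monoid_object) n : C n 1 := ccomp (oone mu) (cterm n).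

(* The submonoid of C(n, 1) generated by the composites of the projections with
   the endomorphisms of 1. *)
Inductive unary_generated (mu : monoid_object) n : C n 1 -> Prop :=
| UnaryGen (f : C 1 1) (i : 'I_n) : unary_generated mu (ccomp f (cproj i))
| UnaryOne : unary_generated mu (cone mu n)
| UnaryMul (f g : C n 1) : unary_generated mu f -> unary_generated mu g ->
    unary_generated mu (cmul mu f g).

Definition Mstar (mu : monoid_object) : Prop :=
  forall n (f : C n 1), unary_generated mu f.

End FiniteProducts.

Section LawvereMonad.
Variables (k : comPzRingType) (C : lawvere).

(* The index order is reversed: law_hom m n = k[C(n, m)]. *)
Definition law_hom (m n : nat) : lmodType k := freemod k (C n m).

Definition law_comp l m n (x : law_hom n m) (y : law_hom m l) : law_hom n l :=
  flift (fun a => flift (fun b => fgen (ccomp a b)) y) x.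

Fact law_comp_linl n m l (y : law_hom m l) :
  linear (fun x : law_hom n m => law_comp x y).
Proof. exact: flift_linear. Qed.

Fact law_comp_linr n m l (x : law_hom n m) :
  linear (fun y : law_hom m l => law_comp x y).
Proof.
move=> a y y'; move: x; apply: free_ext; first exact: flift_linear.
- by move=> c u v; rewrite !law_comp_linl !scalerDr !scalerA (mulrC a) addrACA.
- by move=> f; rewrite /law_comp !flift_gen flift_linear.
Qed.

Lemma law_comp_gen n m l (a : C m n) (b : C l m) :
  law_comp (fgen a) (fgen b) = fgen (ccomp a b).
Proof. by rewrite /law_comp !flift_gen. Qed.

Fact law_compA p n m l (x : law_hom p n) (y : law_hom n m) (z : law_hom m l) :
  law_comp x (law_comp y z) = law_comp (law_comp x y) z.
Proof.
move: x; apply: free_ext; first exact: law_comp_linl.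
  by move=> c u v; rewrite !law_comp_linl.
move=> a; move: y; apply: free_ext.
- by move=> c u v; rewrite law_comp_linl law_comp_linr.
- by move=> c u v; rewrite law_comp_linr law_comp_linl.
move=> b; move: z; apply: free_ext.
- by move=> c u v; rewrite !law_comp_linr.
- exact: law_comp_linr.
by move=> d; rewrite !law_comp_gen ccompA.
Qed.
Fact law_comp1l n m (x : law_hom n m) : law_comp (fgen (cid n)) x = x.
Proof.
move: x; apply: free_ext => //; first exact: law_comp_linr.
by move=> a; rewrite law_comp_gen ccomp1l.
Qed.
Fact law_comp1r n m (x : law_hom n m) : law_comp x (fgen (cid m)) = x.
Proof.
move: x; apply: free_ext => //; first exact: law_comp_linl.
by move=> a; rewrite law_comp_gen ccomp1r.
Qed.

Definition lawmonad : linmonad k nat :=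
  @LinMonad k nat law_hom (fun z y x => @law_comp x y z) (fun n => fgen (cid n))
    law_comp_linl law_comp_linr law_compA law_comp1l law_comp1r.

Variable Z : zero_object C.

(* delta_bar j_bnd is, for 1 <= j <= n, the element
     id_(j-1) x Delta x id_(n-j) - id_j x eta x id_(n-j)
       - id_(j-1) x eta x id_(n-j+1)
   of k[C(n, n+1)], where eta : 0 -> 1 is the zero morphism. *)
Section DeltaBar.
Variables (n j : nat) (j_bnd : (0 < j <= n)%N).

Fact delta_src : (j.-1 + 1 + (n - j) = n)%N.
Proof. by case/andP: j_bnd => j0 jn; rewrite addn1 prednK // subnKC. Qed.
Fact delta_tgt : (j.-1 + 2 + (n - j) = n.+1)%N.
Proof. by rewrite addn2 -[in RHS]delta_src addn1. Qed.
Fact eta_src1 : (j + 0 + (n - j) = n)%N.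
Proof. by case/andP: j_bnd => j0 jn; rewrite addn0 subnKC. Qed.
Fact eta_tgt1 : (j + 1 + (n - j) = n.+1)%N.
Proof. by case/andP: j_bnd => j0 jn; rewrite addn1 addSn subnKC. Qed.
Fact eta_src2 : (j.-1 + 0 + (n - j + 1) = n)%N.
Proof. by rewrite -[RHS]delta_src addn0 -addnA [(1 + _)%N]addnC. Qed.
Fact eta_tgt2 : (j.-1 + 1 + (n - j + 1) = n.+1)%N.
Proof. by rewrite addnA delta_src addn1. Qed.

Definition delta_bar : lawmonad n.+1 n :=
  fgen (ccast delta_src delta_tgt
    (ctimes (ctimes (cid j.-1) (cdiag C)) (cid (n - j))))
  - fgen (ccast eta_src1 eta_tgt1
    (ctimes (ctimes (cid j) (zero_mor Z 0 1)) (cid (n - j))))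
  - fgen (ccast eta_src2 eta_tgt2
    (ctimes (ctimes (cid j.-1) (zero_mor Z 0 1)) (cid (n - j + 1)))).
End DeltaBar.

Inductive delta_bars : forall m n, set (lawmonad m n) :=
| DeltaBars n j (j_bnd : (0 < j <= n)%N) : delta_bars (delta_bar j_bnd).

Definition primitivity_ideal : left_ideal lawmonad := gen_left_ideal delta_bars.

Definition Phi : linmonad k nat := eigenmonad primitivity_ideal.

(* The product of the identities, with a zero morphism in the r-th place. *)
Definition rho d (n : 'I_d -> nat) (r : 'I_d) : C (\sum_i n i)%N (\sum_i n i)%N :=
  cbigtimes (fun i => if i == r then zero_mor Z (n i) (n i) else cid (n i)).

Definition cross_effect (M : lmodule lawmonad) d (n : 'I_d -> nat) :
    set (M (\sum_i n i)%N) :=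
  [set v | forall r : 'I_d, act (fgen (rho n r) : lawmonad _ _) v = 0].

Arguments cross_effect M {d} n.

Definition poly_degree_le (M : lmodule lawmonad) (d : nat) : Prop :=
  forall n : 'I_d.+1 -> nat, cross_effect M n = [set 0].

Definition truncated (N : lmodule Phi) (d : nat) : Prop :=
  forall n, (d < n)%N -> forall v : N n, v = 0.

Definition prim_bimod : bimodule lawmonad Phi := quot_bimod primitivity_ideal.

Definition LL : functor (Mod Phi) (Mod lawmonad) := tensor_functor prim_bimod.
Definition RR : functor (Mod lawmonad) (Mod Phi) := hom_functor prim_bimod.

End LawvereMonad.

(* Main.v *)
Require Import Defs.
From HB Require Import structures.
From mathcomp Require Import all_boot all_order all_algebra.
From mathcomp Require boolp classical_sets.
From mathcomp Require Import zify.

(* The adjunction is tensor-hom adjunction for the bimodule L/I, I being the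
   primitivity ideal. For the degrees, let f have inputs x_1, ..., x_m and
   consider the morphisms obtained from f by replacing x_l with the zero
   morphism in some of the outputs. Modulo I the resulting class is additive in
   the set of outputs in which x_l is kept: the defect of additivity is the
   composite of delta_bar with a morphism on m + 1 inputs, in which the two
   copies of x_l feed disjoint sets of outputs. In particular it vanishes when x_l is dropped everywhere.
   - For RR: rho_r is in I as soon as its r-th block is nonempty, so a map
     L/I(-, n) -> M sends the identity into the cross effect of M for every
     decomposition of n into nonempty blocks; if n > d there is one with d + 1
     blocks.
   - For LL: if the outputs are cut into d blocks with m < d, then f is modulo I
     a sum of morphisms in which every input is kept in a single block only;
     such a morphism misses some block r, hence is fixed by rho_r and killed by
     the projector onto the cross effect. *)

Set Implicit Arguments.
Unset Strict Implicit.
Unset Printing Implicit Defensive.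

Import GRing.Theory.
Local Open Scope ring_scope.

(** * Tensor-hom adjunction for a bimodule *)

Section TensorHomAdjunction.
Variables (k : comPzRingType) (X Y : Type) (T : linmonad k X) (S : linmonad k Y).
Variable B : bimodule T S.

Section Adjunct.
Variables (N : lmodule S) (M : lmodule T).

Section Curry.
Variable f : modhom (tensor_obj B N) M.

Section AtElement.
Variables (y : Y) (v : N y).

Fact curry_elt_linear x : linear (fun b : bimod_col B y x => f x (btens b v)).
Proof. by move=> a b b'; rewrite btens_linl mor_linear. Qed.

Fact curry_elt_act x' x (t : T x' x) (b : bimod_col B y x) :
  f x' (btens (act t b : B x' y) v) = act t (f x (btens b v)).
Proof. by rewrite -mor_act /= bt_actE. Qed.

Definition curry_elt : modhom (bimod_col B y) M :=
  @ModHom k X T (bimod_col B y) M _ curry_elt_linear curry_elt_act.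
End AtElement.

Fact curry_linear y : linear (@curry_elt y : N y -> hom_obj B M y).
Proof. by move=> a u v; apply: modhomP => x b /=; rewrite btens_linr mor_linear. Qed.

Fact curry_act y' y (s : S y' y) (v : N y) :
  curry_elt (act s v) = act s (curry_elt v : hom_obj B M y).
Proof. by apply: modhomP => x b /=; rewrite btens_balanced. Qed.

Definition curry : modhom N (hom_obj B M) :=
  @ModHom k Y S N (hom_obj B M) curry_elt curry_linear curry_act.
End Curry.

Section Uncurry.
Variable g : modhom N (hom_obj B M).

Definition uncurry_fun x y (b : B x y) (v : N y) : M x :=
  (g y v : modhom (bimod_col B y) M) x b.

Definition uncurry_mor x : btensor B N x -> M x := blift (@uncurry_fun x).

Fact uncurry_linl x y (v : N y) : linear (fun b : B x y => uncurry_fun b v).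
Proof. by move=> a b b'; rewrite /uncurry_fun mor_linear. Qed.
Fact uncurry_linr x y (b : B x y) : linear (@uncurry_fun x y b).
Proof. by move=> a v v'; rewrite /uncurry_fun mor_linear. Qed.
(** This is [S]-linearity of [g]: on the Hom module [s] acts by precomposition with [ract]. *)
Fact uncurry_bal x y y' (b : B x y) (s : S y y') (v : N y') :
  uncurry_fun (ract b s) v = uncurry_fun b (act s v).
Proof. by rewrite /uncurry_fun mor_act. Qed.

Fact uncurry_linear x : linear (@uncurry_mor x).
Proof.
apply: blift_linear;
  [exact: uncurry_linl | exact: uncurry_linr | exact: uncurry_bal].
Qed.

Fact uncurry_btens x y (b : B x y) (v : N y) :
  uncurry_mor (btens b v) = uncurry_fun b v.
Proof.
apply: blift_btens;
  [exact: uncurry_linl | exact: uncurry_linr | exact: uncurry_bal].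
Qed.

Fact uncurry_act x' x (t : T x' x) (z : btensor B N x) :
  uncurry_mor (bt_act t z) = act t (uncurry_mor z).
Proof.
move: z; apply: btensor_ext.
- by apply: (lin_comp (f := @uncurry_mor x'));
    [exact: uncurry_linear | exact: bt_act_linr].
- by apply: (lin_comp (f := act t));
    [exact: act_linr | exact: uncurry_linear].
- move=> y b v; rewrite bt_actE !uncurry_btens /uncurry_fun.
  exact: (mor_act (g y v : modhom (bimod_col B y) M)).
Qed.

Definition uncurry : modhom (tensor_obj B N) M :=
  @ModHom k X T (tensor_obj B N) M uncurry_mor uncurry_linear uncurry_act.
End Uncurry.

Lemma curryK : cancel curry uncurry.
Proof.
move=> f; apply: modhomP => x.
have unc : @uncurry_mor (curry f) x =1 f x.
  apply: btensor_ext; [exact: uncurry_linear | exact: (mor_linear f) |].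
  by move=> y b v; rewrite uncurry_btens.
exact: unc.
Qed.

Lemma uncurryK : cancel uncurry curry.
Proof.
move=> g; apply: modhomP => y v; apply: modhomP => x b.
by transitivity (uncurry_mor g (btens b v)); rewrite // uncurry_btens.
Qed.

Lemma curry_bij : bijective curry.
Proof. exact: Bijective curryK uncurryK. Qed.
End Adjunct.

Fact curry_natl (N' N : lmodule S) (M : lmodule T) (u : modhom N' N)
    (f : modhom (tensor_obj B N) M) :
  curry (modhom_comp f (tensor_map B u)) = modhom_comp (curry f) u.
Proof.
by apply: modhomP => y v; apply: modhomP => x b /=; rewrite bt_mapE.
Qed.

Fact curry_natr (N : lmodule S) (M M' : lmodule T) (w : modhom M M')
    (f : modhom (tensor_obj B N) M) :
  curry (modhom_comp w f) = modhom_comp (hom_map B w) (curry f).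
Proof. by apply: modhomP => y v; apply: modhomP. Qed.

Definition tensor_hom : adjunction (tensor_functor B) (hom_functor B) :=
  @Adjunction (Mod S) (Mod T) (tensor_functor B) (hom_functor B)
    curry curry_bij curry_natl curry_natr.

Lemma tensor_homP : is_tensor_hom tensor_hom.
Proof. by []. Qed.
End TensorHomAdjunction.

(** * Zero morphisms and projections with natural-number indices *)

Section ZeroMorphisms.
Variables (C : lawvere) (Z : zero_object C).

Lemma zero_morl m n p (f : C m n) : ccomp (zero_mor Z n p) f = zero_mor Z m p.
Proof. by rewrite /zero_mor -ccompA [ccomp (zto Z n) f]zto_uniq. Qed.

Lemma zero_morr m n p (f : C n p) : ccomp f (zero_mor Z m n) = zero_mor Z m p.
Proof. by rewrite /zero_mor ccompA [ccomp f _]zfrom_uniq. Qed.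

(* Indexing the projections by nat makes them stable under ccast. *)
Definition nproj n (i : nat) : C n 1 :=
  if insub i is Some i' then cproj (i' : 'I_n) else zero_mor Z n 1.

Lemma nproj_ord n (i : 'I_n) : nproj n i = cproj i.
Proof. by rewrite /nproj valK. Qed.

Lemma nprojE n i (lt_in : (i < n)%N) : nproj n i = cproj (Ordinal lt_in).
Proof. exact: (nproj_ord (Ordinal lt_in)). Qed.

(** Taking the value [g] as a family over all sources lets both equalities of objects be
    eliminated. *)
Lemma nproj_ccast m m' n n' (em : m = m') (en : n = n') (f : C m n) i g :
  ccomp (nproj n i) f = g m -> (forall p q (e : p = q), ccast e erefl (g p) = g q) ->
  ccomp (nproj n' i) (ccast em en f) = g m'.
Proof. by case: _ / em; case: _ / en => /= ->. Qed.

Lemma nproj_fst m n i : (i < m)%N -> ccomp (nproj m i) (cfst C m n) = nproj (m + n) i.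
Proof.
by move=> im; rewrite (nprojE im) cproj_tuple -nproj_ord.
Qed.

Lemma nproj_snd m n i : (i < n)%N ->
  ccomp (nproj n i) (csnd C m n) = nproj (m + n) (m + i).
Proof. by move=> lt_in; rewrite (nprojE lt_in) cproj_tuple -nproj_ord. Qed.

Lemma nproj_times m n m' n' (f : C m m') (g : C n n') i : (i < m' + n')%N ->
  @ccomp C (m + n)%N (m' + n')%N 1 (nproj (m' + n') i) (ctimes f g) =
  if (i < m')%N then ccomp (ccomp (nproj m' i) f) (cfst C m n)
  else ccomp (ccomp (nproj n' (i - m')) g) (csnd C m n).
Proof.
move=> li; rewrite (nprojE li) cproj_tuple.
case: fintype.splitP => j /= ->; first by rewrite ltn_ord nproj_ord ccompA.
by rewrite ltnNge leq_addr addKn /= nproj_ord ccompA.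
Qed.

End ZeroMorphisms.

(** * Coordinates of the three terms of [delta_bar] *)

Section DeltaProjections.
Variables (C : lawvere) (Z : zero_object C) (n : nat) (k : 'I_n).

Let k_bnd : (0 < k.+1 <= n)%N := ltn_ord k.

(** [k] counts from 0 where [delta_bar] counts from 1. The three terms share one index formula,
    which collapses outputs [k] and [k.+1] onto input [k]; they differ only in which of these two
    outputs, if any, is zero. *)
Lemma nproj_diag i : (i < n.+1)%N ->
  ccomp (nproj Z n.+1 i) (ccast (delta_src k_bnd) (delta_tgt k_bnd)
    (ctimes (ctimes (cid k) (cdiag C)) (cid (n - k.+1)))) =
  nproj Z n (if (i <= k)%N then i else i.-1).
Proof.
move=> lin; pose g p := nproj Z p (if (i <= k)%N then i else i.-1).
apply: (@nproj_ccast _ _ _ _ _ _ _ _ _ i g); last by move=> p q; case: _ /.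
have lin' : (i < k + 2 + (n - k.+1))%N by rewrite (delta_tgt k_bnd).
rewrite nproj_times // /g; case: ltnP => ik2; last first.
  rewrite ccomp1r nproj_snd; last by lia.
  by congr nproj; case: leqP; lia.
rewrite nproj_times //; case: ltnP => ik.
  by rewrite (ltnW ik) ccomp1r !nproj_fst //; lia.
have i01 : (i - k < 2)%N by lia.
(* Both outputs of the diagonal read its only input. *)
have -> : ccomp (nproj Z 2 (i - k)) (cdiag C) = nproj Z 1 0.
  rewrite (nprojE Z i01) cproj_tuple (nprojE Z (isT : (0 < 1)%N)).
  by case: fintype.split => j; rewrite ccomp1r; congr cproj; apply: val_inj;
    case: j => -[].
rewrite nproj_snd // nproj_fst; last by lia.
by congr nproj; case: leqP; lia.
Qed.

Lemma nproj_insr i : (i < n.+1)%N ->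
  ccomp (nproj Z n.+1 i) (ccast (eta_src1 k_bnd) (eta_tgt1 k_bnd)
    (ctimes (ctimes (cid k.+1) (zero_mor Z 0 1)) (cid (n - k.+1)))) =
  if i == k.+1 then zero_mor Z n 1 else nproj Z n (if (i <= k)%N then i else i.-1).
Proof.
move=> lin; pose g p := if i == k.+1 then zero_mor Z p 1
  else nproj Z p (if (i <= k)%N then i else i.-1).
apply: (@nproj_ccast _ _ _ _ _ _ _ _ _ i g); last by move=> p q; case: _ /.
have lin' : (i < k.+1 + 1 + (n - k.+1))%N by rewrite (eta_tgt1 k_bnd).
rewrite nproj_times // /g; case: ltnP => ik2; last first.
  rewrite ccomp1r nproj_snd; last by lia.
  by rewrite gtn_eqF ?ifF; [congr nproj | |]; lia.
rewrite nproj_times //; case: eqP => [->|nik].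
  by rewrite ltnn zero_morr !zero_morl.
have -> : (i <= k)%N by lia.
by rewrite ifT ?ccomp1r ?nproj_fst //; lia.
Qed.

Lemma nproj_insl i : (i < n.+1)%N ->
  ccomp (nproj Z n.+1 i) (ccast (eta_src2 k_bnd) (eta_tgt2 k_bnd)
    (ctimes (ctimes (cid k) (zero_mor Z 0 1)) (cid (n - k.+1 + 1)))) =
  if i == k then zero_mor Z n 1 else nproj Z n (if (i <= k)%N then i else i.-1).
Proof.
move=> lin; pose g p := if i == k then zero_mor Z p 1
  else nproj Z p (if (i <= k)%N then i else i.-1).
apply: (@nproj_ccast _ _ _ _ _ _ _ _ _ i g); last by move=> p q; case: _ /.
have lin' : (i < k + 1 + (n - k.+1 + 1))%N by rewrite (eta_tgt2 k_bnd).
rewrite nproj_times // /g; case: ltnP => ik2; last first.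
  rewrite ccomp1r nproj_snd; last by lia.
  by rewrite gtn_eqF ?ifF; [congr nproj | |]; lia.
rewrite nproj_times //; case: eqP => [->|nik].
  by rewrite ltnn zero_morr !zero_morl.
have -> : (i <= k)%N by lia.
by rewrite ifT ?ccomp1r ?nproj_fst //; lia.
Qed.
End DeltaProjections.

Lemma mem_gen_left_ideal (k : comPzRingType) (X : Type) (T : linmonad k X)
    (G : forall y x, classical_sets.set (T y x)) y x (f : T y x) :
  G y x f -> f \in gen_left_ideal G y x.
Proof. by move=> Gf; apply/boolp.asboolP => J; apply. Qed.

(** * Masked morphisms modulo the primitivity ideal *)

Section Masks.
Variables (C : lawvere) (Z : zero_object C).

Definition mask n (A : pred 'I_n) : C n n :=
  ctuple (fun l => if A l then cproj l else zero_mor Z n 1).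

(** The mask varies with the output: input [l] reaches output [i] only if [A i l]. Precomposing [f]
    with one mask could not express this. *)
Definition fmask m n (f : C m n) (A : 'I_n -> pred 'I_m) : C m n :=
  ctuple (fun i => ccomp (ccomp (cproj i) f) (mask (A i))).

Lemma eq_fmask m n (f : C m n) A B : A =2 B -> fmask f A = fmask f B.
Proof.
move=> eAB; apply: chom_ext => i; rewrite !cproj_tuple; congr ccomp.
by apply: chom_ext => l; rewrite !cproj_tuple eAB.
Qed.

Lemma fmaskT m n (f : C m n) : fmask f (fun _ _ => true) = f.
Proof.
apply: chom_ext => i; rewrite cproj_tuple [X in ccomp _ X](_ : _ = cid m) ?ccomp1r //.
by apply: chom_ext => l; rewrite cproj_tuple ccomp1r.
Qed.

Lemma mask0 n (A : pred 'I_n) : A =1 xpred0 -> mask A = zero_mor Z n n.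
Proof. by move=> A0; apply: chom_ext => l; rewrite cproj_tuple A0 zero_morr. Qed.

Lemma cproj_rho d (n : 'I_d -> nat) r s :
  ccomp (cproj s) (rho Z n r) =
  if tagnat.sig1 s == r then zero_mor Z _ 1 else cproj s.
Proof.
rewrite cproj_tuple; case: eqP => [_|_]; first by rewrite zero_morl zero_morr.
by rewrite ccomp1l cproj_tuple tagnat.sig2K.
Qed.

Lemma rho_comm d (n : 'I_d -> nat) r s :
  ccomp (rho Z n r) (rho Z n s) = ccomp (rho Z n s) (rho Z n r).
Proof.
apply: chom_ext => i; rewrite !ccompA !cproj_rho.
case er: (tagnat.sig1 i == r); case es: (tagnat.sig1 i == s);
  by rewrite ?zero_morl // ?cproj_rho ?er ?es.
Qed.

Variable k : comPzRingType.
Notation I := (primitivity_ideal k Z).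

Lemma fmask_split m n (f : C m n) (A B D : 'I_n -> pred 'I_m) (j : 'I_m) :
  (forall i l, l != j -> A i l = D i l) ->
  (forall i l, l != j -> B i l = D i l) ->
  (forall i, D i j = A i j (+) B i j) -> (forall i, ~~ (A i j && B i j)) ->
  fgen (fmask f D) - fgen (fmask f A) - fgen (fmask f B) \in I n m.
Proof.
move=> AD BD Dj ABj.
(* [a] has two copies of input [j], at positions [j] and [bump j j], that is [j.+1]. Outputs in
   column [j] of [A] read the first, those of [B] the second; the other inputs are renumbered by
   [bump j]. *)
pose a : C m.+1 n := ctuple (fun i => ccomp (ccomp (cproj i) f)
  (ctuple (fun l => if (l == j) && A i j then nproj Z m.+1 j
    else if D i l then nproj Z m.+1 (bump j l) else zero_mor Z m.+1 1))).
have aE (g : C m m.+1) (E : 'I_n -> pred 'I_m) :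
    (forall i l, ccomp (if (l == j) && A i j then nproj Z m.+1 j
      else if D i l then nproj Z m.+1 (bump j l) else zero_mor Z m.+1 1) g =
      if E i l then nproj Z m l else zero_mor Z m 1) ->
    fmask f E = ccomp a g.
  move=> gE; apply: chom_ext => i; rewrite ccompA !cproj_tuple -!ccompA.
  do 2!congr ccomp; apply: chom_ext => l.
  by rewrite ccompA !cproj_tuple gE nproj_ord.
rewrite (_ : _ - _ = mcomp (fgen a : lawmonad k C _ _)
  (@delta_bar k C Z m j.+1 (ltn_ord j))).
  by apply: (lideal_comp (l := I)); apply: mem_gen_left_ideal; constructor.
rewrite /delta_bar !(linB (mcomp_linr _)) /= !law_comp_gen.
have jm : (j < m.+1)%N := leqW (ltn_ord j).
have bump_lt (l : 'I_m) : (bump j l < m.+1)%N by rewrite /bump; have := ltn_ord l; lia.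
have bumpK (l : 'I_m) :
    (if (bump j l <= j)%N then bump j l else (bump j l).-1) = l :> nat.
  by rewrite /bump; case: ifP; lia.
have bump_neq (l : 'I_m) : (bump j l == j) = false by rewrite /bump; lia.
have bump_eqS (l : 'I_m) : (bump j l == j.+1) = (l == j).
  by rewrite -val_eqE /bump /=; lia.
(* Equal copies give [D]; zero in the second copy leaves [A], zero in the first leaves [B]. *)
congr (fgen _ - fgen _ - fgen _); apply: aE => i l;
  (have [->|lj] := eqVneq l j => /=; [have := ABj i; rewrite ?Dj | rewrite ?AD ?BD //]).
- case: (A i j) (B i j) => -[] //= _; rewrite ?zero_morl // nproj_diag //.
    by rewrite leqnn.
  by rewrite bumpK.
- by case: (D i l); rewrite ?zero_morl // nproj_diag // bumpK.
- case: (A i j) (B i j) => -[] //= _; rewrite ?zero_morl // nproj_insr //.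
    by rewrite ltn_eqF // leqnn.
  by rewrite bump_eqS eqxx.
- by case: (D i l); rewrite ?zero_morl // nproj_insr // bump_eqS (negPf lj) bumpK.
- case: (A i j) (B i j) => -[] //= _; rewrite ?zero_morl // nproj_insl //.
    by rewrite eqxx.
  by rewrite bump_neq bumpK.
- by case: (D i l); rewrite ?zero_morl // nproj_insl // bump_neq bumpK.
Qed.

(** An empty column is the disjoint union of itself with itself, so [fmask_split] with all three
    tables equal to [A] puts minus the element in the ideal. *)
Lemma fmask_column0 m n (f : C m n) (A : 'I_n -> pred 'I_m) (j : 'I_m) :
  (forall i, A i j = false) -> fgen (fmask f A) \in I n m.
Proof.
move=> Aj; have -> : fgen (fmask f A) = -1 *: (fgen (fmask f A) - fgen (fmask f A)
    - fgen (fmask f A)) :> lawmonad k C n m.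
  by rewrite subrr sub0r scaleN1r opprK.
by apply/rpredZ/(@fmask_split _ _ _ _ _ _ j) => // i; rewrite Aj.
Qed.

(** [rho] is the identity with the inputs of block [r] masked everywhere; each of them is an empty
    column, and a nonempty block provides one. *)
Lemma rho_primitivity d (n : 'I_d -> nat) r :
  (0 < n r)%N -> fgen (rho Z n r) \in I _ _.
Proof.
move=> nr; pose s := tagnat.Rank r (Ordinal nr).
rewrite (_ : rho Z n r = fmask (cid _) (fun _ l => tagnat.sig1 l != r)).
  by apply: (@fmask_column0 _ _ _ _ s) => _; rewrite tagnat.Rank1K eqxx.
apply: chom_ext => i; rewrite cproj_rho cproj_tuple ccomp1r cproj_tuple.
by case: eqP.
Qed.

(** A fully masked output is a composite with a zero morphism, hence zero, so [rho] changes nothing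
    in block [r]. *)
Lemma rho_fmask d (n : 'I_d -> nat) r m (f : C m (\sum_i n i)%N) A :
  (forall i l, tagnat.sig1 i = r -> A i l = false) ->
  ccomp (rho Z n r) (fmask f A) = fmask f A.
Proof.
move=> Ar; apply: chom_ext => i; rewrite ccompA cproj_rho; case: eqP => // ir.
by rewrite zero_morl cproj_tuple mask0 ?zero_morr // => l; rewrite Ar.
Qed.

(** [G] abstracts the map that tensors a class with a fixed vector and projects to the cross
    effect. *)
Lemma primitivity_quotient_degree d (n : 'I_d -> nat) m (W : lmodType k)
    (G : lawmonad k C (\sum_i n i)%N m -> W) :
  (m < d)%N -> linear G -> (forall x, x \in I _ _ -> G x = 0) ->
  (forall r g, ccomp (rho Z n r) g = g -> G (fgen g) = 0) ->
  forall x, G x = 0.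
Proof.
move=> md Glin GI Grho; apply: free_ext => //=.
  by move=> ? ? ?; rewrite scaler0 addr0.
(* Induction on [j], the number of inputs not yet confined to one block; the inputs below [m - j]
   already are. *)
move=> f; suff GA j (A : 'I_(\sum_i n i) -> pred 'I_m) : (j <= m)%N ->
    (forall l : 'I_m, (l < m - j)%N -> exists r, forall i, A i l -> tagnat.sig1 i = r) ->
    G (fgen (fmask f A)) = 0.
  by rewrite -[f]fmaskT; apply: (GA m) => // l; rewrite subnn.
elim: j A => [|j IHj] A jm As.
  have /boolp.choice[s sP] : forall l, exists r, forall i, A i l -> tagnat.sig1 i = r.
    by move=> l; apply: As; rewrite subn0.
  (* The [m] inputs meet at most [m < d] blocks, so some block receives none. *)
  have [r rs] : exists r, r \notin codom s.
    apply/existsP; rewrite -[[exists r, _]]negbK negb_exists; apply/negP => /forallP cs.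
    have: (#|'I_d| <= #|codom s|)%N.
      by apply/subset_leq_card/subsetP => r _; have := cs r; rewrite negbK.
    by rewrite leqNgt card_ord (leq_ltn_trans (leq_image_card _ _)) // card_ord.
  apply: (Grho r); apply: rho_fmask => i l ir; apply/negP => /sP sl.
  by case/negP: rs; rewrite -ir sl codom_f.
have lt_jm : (m - j.+1 < m)%N by rewrite ltn_subrL (leq_ltn_trans _ jm).
pose l0 := Ordinal lt_jm.
(* Only column [l0] is cut down, to the blocks in [P]; taking all blocks gives back [A]. *)
pose B (P : pred 'I_d) i (l : 'I_m) := A i l && ((l == l0) ==> P (tagnat.sig1 i)).
rewrite (@eq_fmask _ _ _ _ (B xpredT)); last by move=> i l; rewrite /B implybT andbT.
have Bsingle r : G (fgen (fmask f (B (pred1 r)))) = 0.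
  apply: IHj => [|l]; first exact: ltnW.
  rewrite -(subnSK jm) ltnS leq_eqVlt => /orP[/eqP[ll0]|ll0].
    by exists r => i /andP[_]; rewrite -val_eqE /= ll0 eqxx => /eqP.
  by have [s sP] := As l ll0; exists s => i /andP[/sP].
(* Additivity in column [l0], one block at a time; the empty list is an empty column. *)
have Bseq (rs : seq 'I_d) : uniq rs -> G (fgen (fmask f (B (mem rs)))) = 0.
  elim: rs => [_|r rs IHrs /andP[r_rs /IHrs Brs]].
    by apply/GI/(@fmask_column0 _ _ _ _ l0) => i; rewrite /B eqxx andbF.
  have := @fmask_split _ _ f (B (pred1 r)) (B (mem rs)) (B (mem (r :: rs))) l0.
  move=> /(_ _ _ _ _)/GI; rewrite !(linB Glin) Bsingle Brs !subr0; apply.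
  - by move=> i l /negPf ll0; rewrite /B ll0.
  - by move=> i l /negPf ll0; rewrite /B ll0.
  - move=> i; rewrite /B eqxx /= inE -andb_addr; congr andb.
    by case: eqP => // ->; rewrite (negPf r_rs).
  - move=> i; rewrite /B eqxx /=; apply/negP => /andP[/andP[_ /eqP ir] /andP[_]].
    by rewrite ir (negPf r_rs).
rewrite (@eq_fmask _ _ _ _ (B (mem (enum 'I_d)))) ?Bseq ?enum_uniq //.
by move=> i l; rewrite /B /= mem_enum.
Qed.
End Masks.

(** * Polynomial degree under the two functors *)

Section PolynomialDegree.
Variables (k : comPzRingType) (C : lawvere) (Z : zero_object C).
Notation I := (primitivity_ideal k Z).

(** The class of the identity generates the left module of classes at [n], so its image determines a
    map. *)
Lemma prim_hom_gen (M : lmodule (lawmonad k C)) n (phi : RR k Z M n) m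
    (f : lawmonad k C m n) :
  let psi : modhom (bimod_col (prim_bimod k Z) n) M := phi in
  psi m (quot_pi I f) = act f (psi n (quot_pi I (mid n))).
Proof.
move=> psi; rewrite -(mor_act psi) /=; congr (psi m _).
by rewrite quot_lactE mcomp1r.
Qed.

Lemma RR_truncated d (M : lmodule (lawmonad k C)) :
  poly_degree_le Z M d -> truncated (RR k Z M) d.
Proof.
move=> Mdeg.
(* The object is written as a sum so that [rho] acts on it without a cast. *)
have Mpos (n : 'I_d.+1 -> nat) : (forall i, 0 < n i)%N ->
    forall phi : RR k Z M (\sum_i n i)%N, phi = 0.
  move=> n_gt0 phi; pose psi : modhom (bimod_col (prim_bimod k Z) _) M := phi.
  have phi1 : psi _ (quot_pi I (mid _)) = 0.
    have : @cross_effect k C Z M _ n (psi _ (quot_pi I (mid _))).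
      move=> r /=; rewrite -prim_hom_gen.
      have /qpi_eq0 rho0 := @rho_primitivity C Z k _ n r (n_gt0 r).
      by rewrite /quot_pi rho0 (lin0 (@mor_linear _ _ _ _ _ psi _)).
    by rewrite Mdeg.
  apply: modhomP => m b; have [f ->] := Defs.quotP b.
  by rewrite prim_hom_gen phi1 (lin0 (act_linr f)).
(* There are [d.+1] blocks, of sizes [n - d], 1, ..., 1, all nonempty since [d < n]. *)
move=> n dn; pose ns (i : 'I_d.+1) := if i == ord0 then (n - d)%N else 1%N.
have <- : (\sum_i ns i = n)%N.
  rewrite big_ord_recl /ns eqxx (eq_bigr (fun=> 1%N)) // sum1_card card_ord.
  by rewrite subnK // ltnW.
by apply: Mpos => i; rewrite /ns; case: eqP => //; rewrite subn_gt0.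
Qed.

Section CrossEffectProjector.
Variables (M : lmodule (lawmonad k C)) (d : nat) (n : 'I_d -> nat).

(** The product of the factors [1 - rho r] for [r] in [rs]. A linear operator can be tested on pure
    tensors, unlike membership in the cross effect. *)
Fixpoint cross_proj (rs : seq 'I_d) (v : M (\sum_i n i)%N) : M (\sum_i n i)%N :=
  if rs is r :: rs' then cross_proj rs' (v - act (fgen (rho Z n r) : lawmonad k C _ _) v)
  else v.

Lemma cross_proj_linear rs : linear (cross_proj rs).
Proof.
elim: rs => [|r rs IHrs] a u v //=; rewrite -IHrs; congr cross_proj.
by rewrite act_linr scalerBr opprD addrACA.
Qed.

Lemma cross_proj_id rs v : @cross_effect k C Z M d n v -> cross_proj rs v = v.
Proof. by move=> crv; elim: rs => //= r rs; rewrite crv subr0. Qed.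

(** The factor for [r] kills [g]. Those applied before it preserve the hypothesis: by [rho_comm],
    [rho s] after [g] is again fixed by [rho r]. *)
Lemma cross_proj_fixed rs r m (g : C m (\sum_i n i)%N) (v : M m) :
  r \in rs -> ccomp (rho Z n r) g = g ->
  cross_proj rs (act (fgen g : lawmonad k C _ _) v) = 0.
Proof.
elim: rs g => //= s rs IHrs g; rewrite inE => r_rs rg.
rewrite actA /= law_comp_gen; case/orP: r_rs => [/eqP<-|r_rs].
  by rewrite rg subrr (lin0 (cross_proj_linear rs)).
rewrite (linB (cross_proj_linear rs)) !IHrs ?subr0 //.
by rewrite ccompA rho_comm -ccompA rg.
Qed.
End CrossEffectProjector.

Lemma LL_poly_degree d (N : lmodule (Phi k Z)) :
  truncated N d -> poly_degree_le Z (LL k Z N) d.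
Proof.
move=> Ntr n; apply/classical_sets.seteqP; split=> v; last first.
  by move=> -> r; rewrite (lin0 (act_linr _)).
(* The projector fixes [v], so it suffices that it vanishes on every element. *)
move=> crv; rewrite /= -(cross_proj_id (enum 'I_d.+1) crv).
pose P := @cross_proj (LL k Z N) _ n (enum 'I_d.+1).
have Plin : linear P by exact: cross_proj_linear.
rewrite -/(P v).
move: v {crv}; apply: btensor_ext => //; first by move=> ? ? ?; rewrite scaler0 addr0.
(* For [y > d] the vector [u] is zero; otherwise [y] is less than the number [d.+1] of blocks and
   [primitivity_quotient_degree] applies. *)
move=> y b u; have [dy|yd] := ltnP d y.
  by rewrite (Ntr _ dy u) (lin0 (btens_linr b)) (lin0 Plin).
have [x ->] := Defs.quotP b.
pose G (x : lawmonad k C _ y) := P (btens (quot_pi I x : prim_bimod k Z _ _) u).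
apply: (@primitivity_quotient_degree _ Z _ _ n y _ G) => //.
- by move=> a x1 x2; rewrite /G quot_pi_linear btens_linl Plin.
- by move=> z /qpi_eq0 Iz; rewrite /G /quot_pi Iz (lin0 (btens_linl u)) (lin0 Plin).
move=> r g rg; rewrite /G.
pose e : prim_bimod k Z y y := quot_pi I (mid y).
(* Moving [g] out of the tensor turns it into an action, as [cross_proj_fixed] requires. *)
have -> : btens (quot_pi I (fgen g) : prim_bimod k Z _ _) u =
    act (fgen g : lawmonad k C _ _) (btens e u : LL k Z N y).
  rewrite /= bt_actE; congr btens.
  by rewrite /= /e quot_lactE mcomp1r.
by apply: (cross_proj_fixed _ _ rg); rewrite mem_enum.
Qed.
End PolynomialDegree.

Theorem theorem2 (k : comPzRingType) (C : lawvere) (Z : zero_object C) :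
  (exists A : adjunction (LL k Z) (RR k Z), is_tensor_hom A) /\
  (forall mu : monoid_object C, Mstar mu ->
   forall d : nat,
     (forall M : lmodule (lawmonad k C),
        poly_degree_le Z M d -> truncated (RR k Z M) d) /\
     (forall N : lmodule (Phi k Z),
        truncated N d -> poly_degree_le Z (LL k Z N) d)).
Proof.
split; first by exists (tensor_hom (prim_bimod k Z)); exact: tensor_homP.
by move=> _ _ d; split=> [M|N]; [exact: RR_truncated | exact: LL_poly_degree].
Qed.
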